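(* Let $\mathbb{K} = \mathbb{C}$ or $\mathbb{R}$ and let $f \colon \mathbb{K}^2 \to \mathbb{K}$ be a polynomial of degree $d$ with $f(0) = 0$. Then $$\mathscr{L}(f) \le 1 - \frac{1}{(d-1)^2 + 1},$$ where $\mathscr{L}(f)$ is the {\L}ojasiewicz gradient exponent of $f$ at the origin.
   Context: The polynomial $f$ is nonzero (so $d \ge 1$). The {\L}ojasiewicz gradient exponent $\mathscr{L}(f)$ of $f$ at the origin is the minimum of the exponents $\ell \ge 0$ for which there are constants $c, \epsilon > 0$ with $\|\nabla f(z)\| \ge c\,|f(z)|^{\ell}$ for all $z \in \mathbb{K}^2$ with $\|z\| < \epsilon$, where $\nabla f$ is the vector of partial derivatives (this minimum exists and is a rational number in $[0,1)$). *)

(* Defs.v *)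
From HB Require Import structures.
From mathcomp Require Import all_boot all_order all_algebra.
From mathcomp Require Import complex.
From mathcomp Require Import all_classical all_reals all_analysis.
(* The notations of mpoly clash with those of all_analysis. *)
From mathcomp Require Import -(notations) mpoly.

Set Implicit Arguments.
Unset Strict Implicit.
Unset Printing Implicit Defensive.
Import Order.TTheory GRing.Theory Num.Theory.
Local Open Scope classical_set_scope.
Local Open Scope ring_scope.

(* The scalar field K is R with absr, or R[i] with absc: the library norm on
   R[i] takes its values in R[i], so the real-valued modulus is passed
   explicitly. *)
Definition absr (R : realType) (x : R) : R := `|x|.
Definition absc (R : realType) (z : complex R) : R :=
  ComplexField.Normc.normc z.

(* [mmeasure mdeg] (abbreviated [msize] in mpoly) is one plus the total degree,
   and 0 on the zero polynomial. *)
Definition mdegree (n : nat) (K : comNzRingType) (f : mpoly n K) : nat :=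
  (mmeasure mdeg f).-1.

Section Lojasiewicz.
Variables (R : realType) (K : comNzRingType) (abs : K -> R) (n : nat).

Definition vnorm (v : 'I_n -> K) : R := Num.sqrt (\sum_i abs (v i) ^+ 2).

Definition gradient (f : mpoly n K) (z : 'I_n -> K) : 'I_n -> K :=
  fun i => meval z (mderiv i f).

(* [powR] satisfies 0 `^ 0 = 1 and 0 `^ l = 0 for l != 0. *)
Definition gradient_exponents (f : mpoly n K) : set R :=
  [set l | 0 <= l /\ exists c eps : R, [/\ 0 < c, 0 < eps &
     forall z : 'I_n -> K, vnorm z < eps ->
       c * abs (meval z f) `^ l <= vnorm (gradient f z)]].

(* The minimum of the set of exponents, totalized as an infimum in \bar R: it
   equals the minimum whenever the minimum exists (lojasiewicz_exponent_min),
   and it is +oo, not a junk value, if there is no exponent at all. *)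
Definition lojasiewicz_exponent (f : mpoly n K) : \bar R :=
  ereal_inf (EFin @` gradient_exponents f).

Lemma lojasiewicz_exponent_min (f : mpoly n K) (l : R) :
  gradient_exponents f l ->
  (forall l', gradient_exponents f l' -> l <= l') ->
  lojasiewicz_exponent f = l%:E.
Proof.
move=> fl lmin; apply/le_anti/andP; split.
  by apply: ereal_inf_lbound; exists l.
by apply: le_ereal_inf_tmp => _ [l' fl' <-]; rewrite lee_fin lmin.
Qed.

Lemma lojasiewicz_exponent_set0 (f : mpoly n K) :
  gradient_exponents f = set0 -> lojasiewicz_exponent f = +oo%E.
Proof. by rewrite /lojasiewicz_exponent => ->; rewrite image_set0 ereal_inf0. Qed.

End Lojasiewicz.

(* Main.v *)
Require Import Defs.
From mathcomp Require Import all_boot all_order all_algebra.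
From mathcomp Require Import complex.
From mathcomp Require Import all_classical all_reals all_analysis.
From mathcomp Require Import -(notations) mpoly.
From mathcomp Require Import ring lra zify.

(** Write [p] and [q] for the partial derivatives of [f], let [e = d - 1] and
    [N = e ^ 2].  The bound to prove is [N / (N + 1)], so the inequality behind
    it is |f|^N <= K |grad f|^(N+1) near the origin; it will be reached up to an
    arbitrarily small loss in the exponent, which an infimum does not see.  A
    real polynomial satisfies every inequality that its complexification
    satisfies, and 0 is an exponent when grad f(0) <> 0; hence let [f] be complex
    with grad f(0) = 0.

    The directions of the gradient are recorded by the ratio [s = p / q]; the
    curve [p = s q] is a polar curve of [f].  The argument treats the polar
    curves with [|s| = delta], for one generic [delta], and then recovers the
    other directions.

    - Gap.  The products f^k p^i q^j with k <= N and i + j < D outnumber, for D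
      large, the monomials that can occur in them, so they are linearly
      dependent ([algebraic_relation]); this is how the Bezout number e^2 enters.
      Put p = s q and f = t q in the relation.  Its terms of least total degree
      give t^k0 (B(s) + O(t)) = O(q) with k0 <= N and B a nonzero polynomial.  If
      the circle |s| = delta avoids the roots of B, then on it either |t| >= e0
      for a constant e0, or |t|^N = O(|q|), that is |f|^N = O(|q|^(N+1))
      ([small_ratio_gap]).

    - Walk.  The first alternative, |f| >= e0 |q|, cannot occur close to the
      origin unless f = 0 ([walk]).  Along the polar curve of [s], f varies like
      df = q dw where w = s x + y, so that |d log f / dw| <= 1 / e0 there.  By the
      gap, a point of the curve where |f| >= e0 |q| can be moved along the curve,
      with w shrinking to 0, without leaving this region; f then stays away from
      0, although the walk ends at the origin where f = 0.  The curve may be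
      singular, so the motion is discrete: when w changes by h, the root of
      p - s q on the line of parameter w is replaced by the nearest root on the
      next line, and f changes by q h + o(h) whatever the multiplicities, because
      a polynomial varies slowly between a point and the nearest critical point
      ([nearest_critical]).

    - Maximum principle.  On a line w = delta x + y with w small, consider
      f^a / q^b where |p| < delta |q|, and f^a / p^b where |p| > delta |q|, with
      a / b slightly larger than N / (N + 1).  These are nonconstant rational
      functions without poles in the two regions, so the maximum of
      |f|^a / max (|p|, delta |q|)^b over a disc is attained on the circle bounding
      the disc or where |p| = delta |q|, and both places are under control
      ([slice_max]).  At the common zeros of p and q the quotient tends to 0, since
      the multiplicity of a root of f is at most d <= N + 1. *)

Set Implicit Arguments.
Unset Strict Implicit.
Unset Printing Implicit Defensive.
Import Order.TTheory GRing.Theory Num.Theory numFieldNormedType.Exports.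
Local Open Scope ring_scope.

#[local] Arguments absc : simpl never.

(** * The modulus of a complex number *)

Section Modulus.
Variable R : realType.
Local Notation C := (complex R).
Implicit Types z w : C.

Lemma absc_ge0 z : 0 <= absc z.
Proof. by case: z => a b; rewrite /absc /= sqrtr_ge0. Qed.

Lemma absc0 : absc (0 : C) = 0.
Proof. exact: ComplexField.Normc.normc0. Qed.

Lemma absc1 : absc (1 : C) = 1.
Proof. exact: ComplexField.Normc.normc1. Qed.

Lemma abscM z w : absc (z * w) = absc z * absc w.
Proof. exact: ComplexField.Normc.normcM. Qed.

Lemma abscV z : absc z^-1 = (absc z)^-1.
Proof. exact: ComplexField.Normc.normcV. Qed.

Lemma abscN z : absc (- z) = absc z.
Proof. by case: z => a b; rewrite /absc /= !sqrrN. Qed.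

Lemma absc_distC z w : absc (z - w) = absc (w - z).
Proof. by rewrite -abscN opprB. Qed.

Lemma abscX z k : absc (z ^+ k) = absc z ^+ k.
Proof. by elim: k => [|k IH]; rewrite ?expr0 ?absc1// !exprS abscM IH. Qed.

Lemma absc_eq0 z : (absc z == 0) = (z == 0).
Proof.
apply/eqP/eqP => [|->]; last exact: absc0.
exact: ComplexField.Normc.eq0_normc.
Qed.

Lemma absc_gt0 z : (0 < absc z) = (z != 0).
Proof. by rewrite lt_neqAle absc_ge0 andbT eq_sym absc_eq0. Qed.

Lemma absc_leD z w : absc (z + w) <= absc z + absc w.
Proof. exact: le_normcD. Qed.

Lemma absc_leB z w : absc (z - w) <= absc z + absc w.
Proof. by rewrite -(abscN w) absc_leD. Qed.

Lemma absc_geB z w : absc z - absc w <= absc (z - w).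
Proof. by rewrite lerBlDr -{1}(subrK w z) absc_leD. Qed.

Lemma absc_geD z w : absc z - absc w <= absc (z + w).
Proof. by rewrite -(abscN w) -{2}(opprK w) absc_geB. Qed.

Lemma absc_perturb z w (t u : R) :
  t <= absc z -> absc (w - z) <= u -> t - u <= absc w.
Proof.
by move=> tz wzu; have := absc_geB z (z - w); rewrite subKr absc_distC; lra.
Qed.

Lemma absc_real (x : R) : absc (x%:C%C) = `|x|.
Proof. by rewrite /absc /= expr0n /= addr0 sqrtr_sqr. Qed.

Lemma absc_nat k : absc (k%:R : C) = k%:R.
Proof. by rewrite -(rmorph_nat (real_complex R)) absc_real normr_nat. Qed.

Lemma absc_sum (I : Type) (r : seq I) (P : pred I) (F : I -> C) :
  absc (\sum_(i <- r | P i) F i) <= \sum_(i <- r | P i) absc (F i).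
Proof.
elim/big_rec2: _ => [|i y x _ le_yx]; first by rewrite absc0.
by apply: (le_trans (absc_leD _ _)); rewrite lerD2l.
Qed.

Lemma absc_prod (I : Type) (r : seq I) (P : pred I) (F : I -> C) :
  absc (\prod_(i <- r | P i) F i) = \prod_(i <- r | P i) absc (F i).
Proof. by elim/big_rec2: _ => [|i y x _ <-]; rewrite ?absc1 ?abscM. Qed.

End Modulus.

(** * Polynomials in one complex variable *)

Section Univariate.
Variable R : realType.
Local Notation C := (complex R).
Implicit Types (P Q g h : {poly C}) (x y z : C).

Lemma horner_bounded P (rho : R) :
  exists2 B, 0 < B & forall x, absc x <= rho -> absc P.[x] <= B.
Proof.
exists (1 + \sum_(i < size P) absc P`_i * `|rho| ^+ i).
  by rewrite ltr_wpDr // sumr_ge0 // => i _; rewrite mulr_ge0 ?absc_ge0 ?exprn_ge0.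
move=> x hx; rewrite horner_coef; apply: (le_trans (absc_sum _ _ _)).
rewrite ler_wpDl //; apply: ler_sum => i _.
rewrite abscM abscX ler_wpM2l ?absc_ge0 // lerXn2r ?nnegrE ?absc_ge0 //.
exact: le_trans (ler_norm _).
Qed.

Lemma horner_continuous P x (e : R) : 0 < e ->
  exists2 eta, 0 < eta & forall y, absc (y - x) < eta -> absc (P.[y] - P.[x]) < e.
Proof.
move=> e0; have /factor_theorem[q qE] : root (P - P.[x]%:P) x.
  by rewrite rootE !hornerE subrr.
have [B B0 hB] := horner_bounded q (absc x + 1).
exists (Num.min 1 (e / B)) => [|y]; first by rewrite lt_min ltr01 divr_gt0.
rewrite lt_min ltr_pdivlMr // => /andP[y1 ye].
have -> : P.[y] - P.[x] = q.[y] * (y - x).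
  by have := congr1 (horner^~ y) qE; rewrite !hornerE.
rewrite abscM (le_lt_trans _ ye) // mulrC ler_wpM2l ?absc_ge0 // hB //.
by rewrite -(subrK x y) addrC (le_trans (absc_leD _ _)) // lerD2l ltW.
Qed.

(** The factorization over the algebraically closed field, packaged with the
    degree and the root set so that estimates reduce to products of distances
    to the roots. *)
Lemma prod_XsubC_lead P :
  {rs : seq C | P = lead_coef P *: \prod_(z <- rs) ('X - z%:P)
     & P != 0 -> size P = (size rs).+1 /\ forall z, root P z = (z \in rs)}.
Proof.
have [rs PE] := closed_field_poly_normal P.
exists rs => // P0; have l0 : lead_coef P != 0 by rewrite lead_coef_eq0.
split; first by rewrite PE size_scale // size_prod_XsubC.
by move=> z; rewrite PE rootZ // root_prod_XsubC.
Qed.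

(** Beyond the sum of the moduli of the roots plus 1, every factor [s - z] has
    modulus at least 1.  This makes all circles of large radius generic. *)
Lemma lead_coef_le_horner P : P != 0 ->
  exists2 r : R, 0 < r &
    forall s, r <= absc s -> absc (lead_coef P) <= absc P.[s].
Proof.
move=> P0; have [rs PE _] := prod_XsubC_lead P.
exists (1 + \sum_(z <- rs) absc z) => [|s hs].
  by rewrite ltr_wpDr // sumr_ge0 // => z _; apply: absc_ge0.
rewrite {2}PE hornerZ abscM horner_prod absc_prod ler_peMr ?absc_ge0 //.
elim: rs {PE} hs => [|z rs IH] /=; first by rewrite !big_nil.
rewrite !big_cons => hs; rewrite -{1}[1]mulr1 ler_pM //.
  rewrite hornerXsubC (le_trans _ (absc_geB _ _)) //.
  have : 0 <= \sum_(j <- rs) absc j by apply: sumr_ge0 => j _; apply: absc_ge0.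
  by lra.
by apply: IH; apply: le_trans hs; rewrite lerD2l lerDr absc_ge0.
Qed.

Lemma coef_prod_XsubC_le (rs : seq C) (rho : R) k : 0 <= rho ->
  (forall z, z \in rs -> rho <= absc z) ->
  absc (\prod_(z <- rs) ('X - z%:P))`_k * rho ^+ k
    <= 2 ^+ size rs * \prod_(z <- rs) absc z.
Proof.
move=> rho0; elim: rs k => [|z rs IH] k hrs.
  rewrite !big_nil coef1 mulr1 expr0; case: k => [|k] /=.
    by rewrite absc1 mulr1.
  by rewrite absc0 mul0r.
have hz : rho <= absc z by apply: hrs; rewrite mem_head.
have {}IH j := IH j (fun w hw => hrs w (mem_behead (s := z :: rs) hw)).
rewrite !big_cons /= exprS mulrBl coefB coefXM coefCM.
set p := \prod_(j <- rs) _ in IH *.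
set B := _ * _ in IH; have B0 : 0 <= B by rewrite (le_trans _ (IH 0)) // mulr_ge0 ?absc_ge0 ?expr0.
have -> : 2 * 2 ^+ size rs * (absc z * \prod_(j <- rs) absc j) = absc z * B + absc z * B.
  by rewrite /B; ring.
apply: (@le_trans _ _ ((absc (if k == 0 then 0 else p`_k.-1) + absc (z * p`_k)) * rho ^+ k)).
  by rewrite ler_wpM2r ?exprn_ge0 // absc_leB.
rewrite mulrDl abscM -mulrA lerD ?ler_wpM2l ?absc_ge0 //.
case: k => [|k] /=; first by rewrite absc0 mul0r mulr_ge0 ?absc_ge0.
by rewrite exprS mulrCA ler_pM ?mulr_ge0 ?absc_ge0 ?exprn_ge0.
Qed.

(** If no root of [Q] is closer to [x] than [rho], the Taylor coefficients of
    [Q] at [x] are bounded by those of a product of factors [X - z] with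
    [|z| >= rho], each of which at most doubles when [X] is replaced by [rho]. *)
Lemma coef_shift_le Q n x (rho : R) k : (size Q <= n.+1)%N -> 0 <= rho ->
  (forall z, root Q z -> rho <= absc (z - x)) ->
  absc (Q \Po ('X + x%:P))`_k * rho ^+ k <= 2 ^+ n * absc Q.[x].
Proof.
move=> sQ rho0 hQ; have [->|Q0] := eqVneq Q 0.
  by rewrite comp_poly0 coef0 horner0 absc0 mul0r mulr0.
have [rs QE /(_ Q0)[sE rE]] := prod_XsubC_lead Q.
have sn : (size rs <= n)%N by rewrite -ltnS -sE.
pose ts := [seq z - x | z <- rs].
have -> : Q \Po ('X + x%:P) = lead_coef Q *: \prod_(z <- ts) ('X - z%:P).
  rewrite {1}QE comp_polyZ rmorph_prod big_map; congr (_ *: _).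
  by apply: eq_bigr => z _ /=; rewrite comp_polyB comp_polyX comp_polyC polyCB opprB addrA.
have -> : absc Q.[x] = absc (lead_coef Q) * \prod_(z <- ts) absc z.
  rewrite {1}QE hornerZ abscM horner_prod absc_prod big_map; congr (_ * _).
  by apply: eq_bigr => z _; rewrite hornerXsubC absc_distC.
rewrite coefZ abscM -mulrA [leRHS]mulrCA ler_wpM2l ?absc_ge0 //.
apply: (le_trans (@coef_prod_XsubC_le ts rho k rho0 _)).
  by move=> _ /mapP[z zrs ->]; apply: hQ; rewrite rE.
rewrite ler_wpM2r ?prodr_ge0 // => [z _|]; first exact: absc_ge0.
by rewrite size_map ler_weXn2l // ler1n.
Qed.

Lemma nearest_root Q x : (1 < size Q)%N ->
  exists2 r, root Q r & forall z, root Q z -> absc (r - x) <= absc (z - x).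
Proof.
move=> sQ; have Q0 : Q != 0 by apply: contraTneq sQ => ->; rewrite size_poly0.
have [rs _ /(_ Q0)[sE rE]] := prod_XsubC_lead Q.
have {sE sQ}: rs != [::] by apply: contraTneq sQ => rs0; rewrite sE rs0.
suff: rs != [::] -> exists2 r, r \in rs & forall z, z \in rs -> absc (r - x) <= absc (z - x).
  by move=> H /H[r rrs hr]; exists r; rewrite ?rE // => z; rewrite rE; apply: hr.
elim: rs {rE} => [//|a [|b rs] IH] _.
  by exists a; rewrite ?mem_head // => z; rewrite inE => /eqP->.
have [//|r rrs hr] := IH.
have [le_ra|/ltW le_ar] := leP (absc (r - x)) (absc (a - x)).
  exists r; first by rewrite inE rrs orbT.
  by move=> z; rewrite inE => /predU1P[->//|/hr].
exists a; first by rewrite mem_head.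
by move=> z; rewrite inE => /predU1P[->//|/hr]; apply: le_trans.
Qed.

Lemma deriv_comp_XaddC P x : (P \Po ('X + x%:P))^`() = P^`() \Po ('X + x%:P).
Proof. by rewrite deriv_comp derivD derivX derivC addr0 mulr1. Qed.

(** Moving from [x] to the nearest critical point [x'] changes [P] by little
    more than |x' - x| |P'(x)|: on the disc around [x] that reaches to [x'], P'
    cannot exceed a constant times |P'(x)|.  The last clause says that [x'] is
    near [x] as soon as P'(x) is small compared with some value P'(y).  Both
    constants depend on the degree only, and multiple roots are allowed. *)
Lemma nearest_critical n P x : (size P <= n.+1)%N -> (1 < size P^`())%N ->
  exists x', [/\ root P^`() x',
    absc (P.[x'] - P.[x]) <= n%:R * 2 ^+ n * absc (x' - x) * absc P^`().[x] &
    forall y (eta : R), 0 < eta -> eta <= absc (x' - x) ->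
      absc P^`().[y] <= (absc (y - x) / eta + 1) ^+ n * absc P^`().[x]].
Proof.
move=> sP sP'; have [x' rx' minx'] := nearest_root x sP'.
have sn : (size P^`() <= n.+1)%N by rewrite (leq_trans (size_poly _ _)) // (leq_trans (leq_pred _)).
have P0 : P^`() != 0 by apply: contraTneq sP' => ->; rewrite size_poly0.
exists x'; split=> //.
  set rho := absc (x' - x) in minx' *; have rho0 : 0 <= rho := absc_ge0 _.
  pose T := P \Po ('X + x%:P).
  have TE y : P.[y] = T.[y - x] by rewrite horner_comp !hornerE subrK.
  have sT : (size T <= n.+1)%N by rewrite size_comp_poly2 ?size_XaddC.
  rewrite [P.[x']]TE [P.[x]]TE subrr.
  rewrite (horner_coef_wide _ sT) horner_coef0 big_ord_recl expr0 mulr1 addrAC subrr add0r.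
  apply: (le_trans (absc_sum _ _ _)).
  apply: (@le_trans _ _ (\sum_(i < n) (2 ^+ n * rho * absc P^`().[x]))); last first.
    by rewrite sumr_const card_ord -[leLHS]mulr_natl !mulrA.
  apply: ler_sum => i _; rewrite lift0 abscM abscX -/rho exprS.
  have := coef_shift_le i sn rho0 minx'.
  rewrite -deriv_comp_XaddC -/T coef_deriv -[_ *+ _.+1]mulr_natl abscM absc_nat => H.
  rewrite mulrCA [2 ^+ n * _]mulrC -mulrA ler_wpM2l //; apply: le_trans H.
  by rewrite -mulrA ler_peMl ?mulr_ge0 ?absc_ge0 ?exprn_ge0 // ler1n.
move=> y eta eta0 le_eta.
have [rs QE /(_ P0)[sE rE]] := prod_XsubC_lead P^`().
have le_rs : (size rs <= n)%N by rewrite -ltnS -sE.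
rewrite {1 2}QE !hornerZ !abscM !horner_prod !absc_prod [leRHS]mulrCA ler_wpM2l ?absc_ge0 //.
have t1 : 1 <= absc (y - x) / eta + 1 by rewrite lerDr divr_ge0 ?absc_ge0 // ltW.
set t := _ + 1 in t1 *.
have prod_ge0 : 0 <= \prod_(z <- rs) absc (('X - z%:P).[x]).
  by apply: prodr_ge0 => z _; apply: absc_ge0.
apply: (@le_trans _ _ (t ^+ size rs * \prod_(z <- rs) absc (('X - z%:P).[x]))); last first.
  by rewrite ler_wpM2r // ler_weXn2l.
have hz z : z \in rs -> absc ('X - z%:P).[y] <= t * absc ('X - z%:P).[x].
  rewrite -rE => /minx' le_z; rewrite !hornerXsubC.
  have -> : y - z = (y - x) + (x - z) by ring.
  apply: (le_trans (absc_leD _ _)); rewrite /t mulrDl mul1r lerD2r.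
  rewrite -mulrA ler_peMr ?absc_ge0 // [eta^-1 * _]mulrC ler_pdivlMr // mul1r.
  by rewrite (le_trans le_eta) // (le_trans le_z) // absc_distC.
clear -hz t1; elim: rs hz => [|z rs IH] hz; first by rewrite !big_nil mulr1.
rewrite !big_cons /= exprS mulrACA ler_pM ?prodr_ge0 ?absc_ge0 //.
- by move=> *; apply: absc_ge0.
- by apply: hz; rewrite mem_head.
- by apply: IH => w hw; apply: hz; rewrite inE hw orbT.
Qed.

(** The local maximum principle for the rational function [g / h], with the
    denominators cleared.  The difference h(x) g - g(x) h vanishes at [x] to a
    finite order k > 0, and a suitable k-th root [u] gives a direction in which
    it is, to first order, a positive multiple of g(x) h(x). *)
Lemma no_local_max_quotient g h x (eta : R) : g.[x] != 0 -> h.[x] != 0 ->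
  h.[x] *: g != g.[x] *: h -> 0 < eta ->
  exists2 y, absc (y - x) < eta &
    absc g.[x] * absc h.[y] < absc h.[x] * absc g.[y].
Proof.
move=> gx hx ne eta0; pose H := h.[x] *: g - g.[x] *: h.
have H0 : H != 0 by rewrite subr_eq0.
have [[|k] [q]] := multiplicity_XsubC H x; rewrite H0 /= => qx HE.
  by move: qx; rewrite -[q]mulr1 -HE rootE /H !hornerE mulrC subrr eqxx.
have qx0 : q.[x] != 0 by [].
(* The direction [u] makes u^(k+1) q equal to g(x) h(x) at [x]. *)
have [u uE] : exists u, u ^+ k.+1 = g.[x] * h.[x] / q.[x].
  by exists (k.+1.-root (g.[x] * h.[x] / q.[x])); rewrite rootCK.
have u0 : u != 0.
  apply: contra_eq_neq uE => ->; rewrite expr0n /= eq_sym !mulf_neq0 ?invr_eq0 //.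
pose E := u ^+ k.+1 *: q - g.[x] *: h.
have Ex : E.[x] = 0 by rewrite /E !hornerE uE mulfVK // subrr.
have A0 : 0 < absc (g.[x] * h.[x]) / 2 by rewrite divr_gt0 // absc_gt0 mulf_neq0.
have [e1 e10 he1] := horner_continuous E x A0.
have [e2 e20 he2] := horner_continuous (g.[x] *: h) x A0.
pose e := Num.min (Num.min eta e1) e2.
have e0 : 0 < e by rewrite !lt_min eta0 e10 e20.
pose t : R := e / (2 * absc u).
have t0 : 0 < t by rewrite divr_gt0 // mulr_gt0 // absc_gt0.
pose y := x + t%:C%C * u.
have ye : absc (y - x) < e.
  rewrite /y addrC addKr abscM absc_real ger0_norm ?ltW // /t invfM mulrA mulfVK ?absc_eq0 //.
  by rewrite ltr_pdivrMr // ltr_pMr // ltr1n.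
move: (ye); rewrite !lt_min => /andP[/andP[ye0 /he1 yE1] /he2 yE2].
exists y => //; move: yE1 yE2; rewrite Ex subr0 !hornerZ => yE1 yE2.
set A := g.[x] * h.[y] in yE2 *.
have ltEA : absc E.[y] < absc A.
  by have := absc_geB (g.[x] * h.[x]) (g.[x] * h.[x] - A); rewrite subKr absc_distC; lra.
have tk : 0 < t ^+ k.+1 by rewrite exprn_gt0.
have -> : absc h.[x] * absc g.[y] = absc (A + (t ^+ k.+1)%:C%C * (A + E.[y])).
  have EE : E.[y] = u ^+ k.+1 * q.[y] - A by rewrite /E !hornerE.
  rewrite -abscM; congr absc; rewrite EE [A + (_ - A)]addrC subrK.
  have := congr1 (horner^~ y) HE; rewrite /H !hornerE => /(canRL (subrK _)) ->.
  have -> : y - x = t%:C%C * u by rewrite /y addrC addKr.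
  by rewrite exprMn rmorphXn /A addrC [q.[y] * _]mulrC.
rewrite -abscM -/A.
have -> : A + (t ^+ k.+1)%:C%C * (A + E.[y]) = (1 + t ^+ k.+1)%:C%C * A + (t ^+ k.+1)%:C%C * E.[y].
  by rewrite rmorphD rmorph1; ring.
apply: lt_le_trans (absc_geD _ _); rewrite !abscM !absc_real.
rewrite (ger0_norm (ltW tk)) (ger0_norm (addr_ge0 ler01 (ltW tk))) mulrDl mul1r.
by rewrite ltrBrDr ltrD2l ltr_pM2l // -abscM.
Qed.

(** At a root of multiplicity k, g^a vanishes to order a k and g'^b to order
    b (k - 1). *)
Lemma near_root_le g r a b (e : R) : (1 < size g)%N -> root g r ->
  (forall k, 0 < k < size g -> b * k.-1 < a * k)%N -> 0 < e ->
  exists2 eta, 0 < eta & forall x, absc (x - r) < eta ->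
    absc g.[x] ^+ a <= e * absc g^`().[x] ^+ b.
Proof.
move=> sg rg hab e0; have g0 : g != 0 by apply: contraTneq sg => ->; rewrite size_poly0.
have [[|k] [q]] := multiplicity_XsubC g r; rewrite g0 /= => qr gE.
  by move: qr; rewrite -[q]mulr1 -gE rg.
have q0 : q != 0 by apply: contraNneq qr => ->; rewrite root0.
have sk : (k.+1 < size g)%N.
  rewrite gE size_Mmonic ?monic_exp ?monicXsubC // size_exp_XsubC addnS /= -{1}(add0n k.+1).
  by rewrite ltn_add2r size_poly_gt0.
have {}hab : (b * k < a * k.+1)%N by apply: (hab k.+1).
pose q2 := q^`() * ('X - r%:P) + k.+1%:R *: q.
have g'E : g^`() = q2 * ('X - r%:P) ^+ k.
  rewrite gE derivM deriv_exp derivXsubC mul1r /q2 exprS /= -mulr_natl scaler_nat -mulr_natl.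
  ring.
have q2r : 0 < absc q2.[r].
  by rewrite absc_gt0 /q2 !hornerE subrr mulr0 add0r mulf_neq0 // pnatr_eq0.
have [e1 e10 he1] := horner_continuous q2 r (divr_gt0 q2r (ltr0Sn _ 1)).
have [B B0 hB] := horner_bounded q (absc r + 1).
pose c := absc q2.[r] / 2; have c0 : 0 < c by rewrite divr_gt0.
pose e2 := e * c ^+ b / B ^+ a.
have e20 : 0 < e2 by rewrite !mulr_gt0 ?invr_gt0 ?exprn_gt0.
exists (Num.min (Num.min e1 e2) 1) => [|x]; first by rewrite !lt_min e10 e20 ltr01.
rewrite !lt_min => /andP[/andP[/he1 x1 x2] x3].
have t0 : 0 <= absc (x - r) := absc_ge0 _; set t := absc (x - r) in x2 x3 t0.
have qx : absc q.[x] <= B.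
  by apply: hB; rewrite -(subrK r x) addrC (le_trans (absc_leD _ _)) // lerD2l ltW.
have q2x : c <= absc q2.[x].
  by have := absc_geB q2.[r] (q2.[r] - q2.[x]); rewrite subKr absc_distC /c; lra.
rewrite {1}gE g'E !hornerM !horner_exp !hornerXsubC !abscM !abscX -/t !exprMn -!exprM.
apply: (@le_trans _ _ (B ^+ a * (t * t ^+ (b * k)))).
  rewrite ler_pM ?exprn_ge0 ?absc_ge0 // ?lerXn2r ?nnegrE ?absc_ge0 ?(ltW B0) //.
  by rewrite -exprS ler_wiXn2l ?(ltW x3) // [(_.+1 * a)%N]mulnC.
apply: (@le_trans _ _ (e * (c ^+ b * t ^+ (k * b)))); last first.
  rewrite ler_wpM2l ?(ltW e0) // ler_wpM2r ?exprn_ge0 // lerXn2r ?nnegrE ?absc_ge0 //.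
  exact: ltW.
rewrite [leLHS]mulrA [(k * b)%N]mulnC [leRHS]mulrA ler_wpM2r ?exprn_ge0 //.
rewrite mulrC -ler_pdivlMr ?exprn_gt0 //; exact: ltW.
Qed.

End Univariate.

(** * Polynomials in two variables and their restrictions to lines *)

Section ProductIdentities.
Variable K : comNzRingType.
Implicit Types a b c d h : K.

(** The ring identities behind the product rules for increments, for first
    order remainders and for derivations. *)
Lemma mul_increment a a' b b' : a' * b' - a * b = (a' - a) * b' + a * (b' - b).
Proof. by ring. Qed.

Lemma add_remainder a a' c b b' d h :
  a' + b' - (a + b) - (c + d) * h = (a' - a - c * h) + (b' - b - d * h).
Proof. by ring. Qed.

Lemma mul_remainder a a' c b b' d h :
  a' * b' - a * b - (c * b + a * d) * h =
  (a' - a - c * h) * b' + a * (b' - b - d * h) + c * h * (b' - b).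
Proof. by ring. Qed.

Lemma mul_derivation a a1 a2 b b1 b2 c :
  (a1 - c * a2) * b + a * (b1 - c * b2) = (a1 * b + a * b1) - c * (a2 * b + a * b2).
Proof. by ring. Qed.

End ProductIdentities.

Section Bivariate.
Variable R : realType.
Local Notation C := (complex R).
Local Notation MP := (mpoly 2 C).
Implicit Types (f g : MP) (x y s w : C).

(** The point of coordinates [x] and [y], over any type: [slice] uses it for polynomials. *)
Definition pt (T : Type) (x y : T) : 'I_2 -> T := fun i => if i == 0 then x else y.
Definition ev f x y : C := meval (pt x y) f.
Definition dx f : MP := mderiv 0 f.
Definition dy f : MP := mderiv 1 f.

(** Estimates on compact sets pass to sums and products, so they hold for all
    polynomials as soon as they hold for constants and variables. *)
Lemma mpoly_ring_ind (Pr : MP -> Prop) :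
  (forall c, Pr (mpolyC 2 c)) -> (forall i, Pr (mpolyX C (mnm1 i))) ->
  (forall f g, Pr f -> Pr g -> Pr (f + g)) ->
  (forall f g, Pr f -> Pr g -> Pr (f * g)) -> forall f, Pr f.
Proof.
move=> hC hX hD hM f; rewrite [f]mpolyE.
elim/big_ind: _ => [|//|m _]; first by rewrite -(mpolyC0 2 C).
rewrite -mul_mpolyC; apply: (hM); first exact: hC.
rewrite mpolyXE_id; elim/big_ind: _ => [|//|i _]; first by rewrite -(mpolyC1 2 C).
elim: (fun_of_multinom m i) => [|k IH]; first by rewrite expr0 -(mpolyC1 2 C).
by rewrite exprS; apply: hM.
Qed.

Lemma evD f g x y : ev (f + g) x y = ev f x y + ev g x y.
Proof. exact: mevalD. Qed.
Lemma evM f g x y : ev (f * g) x y = ev f x y * ev g x y.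
Proof. exact: mevalM. Qed.
Lemma evC c x y : ev (mpolyC 2 c) x y = c.
Proof. exact: mevalC. Qed.
Lemma evX i x y : ev (mpolyX C (mnm1 i)) x y = pt x y i.
Proof. exact: mevalXU. Qed.

Lemma dyD f g : dy (f + g) = dy f + dy g. Proof. exact: mderivD. Qed.
Lemma dyM f g : dy (f * g) = dy f * g + f * dy g. Proof. exact: mderivM. Qed.
Lemma dxD f g : dx (f + g) = dx f + dx g. Proof. exact: mderivD. Qed.
Lemma dxM f g : dx (f * g) = dx f * g + f * dx g. Proof. exact: mderivM. Qed.

Lemma mderiv_X (i j : 'I_2) : mderiv i (mpolyX C (mnm1 j)) = mpolyC 2 (i == j)%:R.
Proof.
rewrite mderivX mnm1E [j == i]eq_sym; case: eqP => [->|_]; last by rewrite scale0r mpolyC0.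
rewrite scale1r mpolyC1 -mpolyX0; congr (mpolyX _ _).
by apply/mnmP => k; rewrite mnmBE subnn mnm0E.
Qed.

Lemma ev_bounded f (rho : R) : exists2 L, 0 < L &
  forall x y, absc x <= rho -> absc y <= rho -> absc (ev f x y) <= L.
Proof.
elim/mpoly_ring_ind: f => [c|i|f g [L L0 hL] [M M0 hM]|f g [L L0 hL] [M M0 hM]].
- exists (absc c + 1); first by rewrite ltr_wpDl ?absc_ge0.
  by move=> x y _ _; rewrite evC lerDl.
- exists (`|rho| + 1); first by rewrite ltr_wpDl.
  move=> x y hx hy; rewrite evX /pt; have := ler_norm rho.
  by case: ifP; lra.
- exists (L + M); first exact: addr_gt0.
  move=> x y hx hy; rewrite evD (le_trans (absc_leD _ _)) //; apply: lerD; [exact: hL|exact: hM].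
- exists (L * M); first exact: mulr_gt0.
  by move=> x y hx hy; rewrite evM abscM ler_pM ?absc_ge0 ?hL ?hM.
Qed.

Lemma ev_lipschitz f (rho : R) : exists2 L, 0 < L &
  forall x y x' y', absc x <= rho -> absc y <= rho -> absc x' <= rho -> absc y' <= rho ->
    absc (ev f x' y' - ev f x y) <= L * (absc (x' - x) + absc (y' - y)).
Proof.
elim/mpoly_ring_ind: f => [c|i|f g [L L0 hL] [M M0 hM]|f g [L L0 hL] [M M0 hM]].
- exists 1 => // x y x' y' *.
  by rewrite !evC subrr absc0 mul1r addr_ge0 ?absc_ge0.
- exists 1 => // x y x' y' *; rewrite !evX mul1r /pt.
  by case: ifP => _; rewrite ?lerDl ?lerDr absc_ge0.
- exists (L + M) => [|x y x' y' hx hy hx' hy']; first exact: addr_gt0.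
  rewrite !evD mulrDl opprD addrACA (le_trans (absc_leD _ _)) //; apply: lerD; [exact: hL|exact: hM].
have [A A0 hA] := ev_bounded f rho; have [B B0 hB] := ev_bounded g rho.
exists (L * B + A * M) => [|x y x' y' hx hy hx' hy']; first by rewrite addr_gt0 ?mulr_gt0.
rewrite !evM mul_increment.
apply: (le_trans (absc_leD _ _)); rewrite [leRHS]mulrDl !abscM lerD //.
  by rewrite mulrAC ler_pM ?absc_ge0 ?hL ?hB.
by rewrite -mulrA ler_pM ?absc_ge0 ?hA ?hM.
Qed.

Lemma ev_taylor f (rho : R) : exists2 L, 0 < L &
  forall x y y', absc x <= rho -> absc y <= rho -> absc y' <= rho ->
    absc (ev f x y' - ev f x y - ev (dy f) x y * (y' - y)) <= L * absc (y' - y) ^+ 2.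
Proof.
elim/mpoly_ring_ind: f => [c|i|f g [L L0 hL] [M M0 hM]|f g [L L0 hL] [M M0 hM]].
- exists 1 => // x y y' *; rewrite /dy mderivC -(mpolyC0 2 C) !evC subrr mul0r subr0 absc0.
  by rewrite mul1r exprn_ge0 ?absc_ge0.
- exists 1 => // x y y' *; rewrite /dy mderiv_X !evX evC /pt.
  have -> : (1 == i) = (i != 0) by rewrite eq_sym; case: i => [[|[|]]].
  rewrite [leRHS]mul1r.
  by case: (i == 0) => /=; rewrite ?mul0r ?mul1r !subrr ?subr0 absc0 exprn_ge0 ?absc_ge0.
- exists (L + M) => [|x y y' hx hy hy']; first exact: addr_gt0.
  rewrite dyD !evD add_remainder [leRHS]mulrDl (le_trans (absc_leD _ _)) //.
  by apply: lerD; [exact: hL|exact: hM].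
have [A A0 hA] := ev_bounded f rho; have [B B0 hB] := ev_bounded g rho.
have [D D0 hD] := ev_bounded (dy f) rho; have [E E0 hE] := ev_lipschitz g rho.
exists (L * B + A * M + D * E) => [|x y y' hx hy hy'].
  by rewrite !addr_gt0 ?mulr_gt0.
rewrite dyM evD !evM mul_remainder; set h := y' - y.
apply: (le_trans (absc_leD _ _)); rewrite [leRHS]mulrDl lerD //.
  apply: (le_trans (absc_leD _ _)); rewrite [leRHS]mulrDl !abscM lerD //.
    by rewrite [leRHS]mulrAC ler_pM ?absc_ge0 ?hL ?hB.
  by rewrite -[leRHS]mulrA ler_pM ?absc_ge0 ?hA ?hM.
rewrite !abscM expr2 mulrACA ler_pM ?mulr_ge0 ?absc_ge0 //.
  by rewrite ler_wpM2r ?absc_ge0 ?hD.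
by have := hE _ _ _ _ hx hy hx hy'; rewrite subrr absc0 add0r.
Qed.

(** The restriction of [f] to the line s x + y = w, parametrized by [x].  The
    derivative of this restriction is p - s q, so its critical points are the
    points of the line that lie on the polar curve of [s]. *)
Definition slice f s w : {poly C} := mmap (@polyC C) (pt 'X (w%:P - s *: 'X)) f.

Lemma sliceC c s w : slice (mpolyC 2 c) s w = c%:P.
Proof. exact: mmapC. Qed.
Lemma sliceX i s w : slice (mpolyX C (mnm1 i)) s w = pt 'X (w%:P - s *: 'X) i.
Proof. by rewrite /slice mmapX mmap1U. Qed.
Lemma sliceD f g s w : slice (f + g) s w = slice f s w + slice g s w.
Proof. exact: mmapD. Qed.
Lemma sliceM f g s w : slice (f * g) s w = slice f s w * slice g s w.
Proof. exact: rmorphM. Qed.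

Lemma slice_horner f s w x : (slice f s w).[x] = ev f x (w - s * x).
Proof.
rewrite /ev mevalE /slice /mmap -horner_evalE rmorph_sum; apply: eq_bigr => m _.
rewrite rmorphM /= horner_evalE hornerC; congr (_ * _).
rewrite /mmap1 rmorph_prod; apply: eq_bigr => i _.
by rewrite rmorphXn /= horner_evalE /pt; case: ifP => _; rewrite !hornerE.
Qed.

Lemma slice_deriv f s w : (slice f s w)^`() = slice (dx f) s w - s *: slice (dy f) s w.
Proof.
elim/mpoly_ring_ind: f => [c|i|f g IHf IHg|f g IHf IHg].
- by rewrite /dx /dy !mderivC -(mpolyC0 2 C) !sliceC derivC scaler0 subr0.
- rewrite /dx /dy !mderiv_X !sliceC sliceX /pt.
  have -> : (1 == i) = (i != 0) by rewrite eq_sym; case: i => [[|[|]]].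
  have -> : (0 == i) = (i == 0) by rewrite eq_sym.
  case: (i == 0) => /=; first by rewrite derivX scaler0 subr0.
  by rewrite derivB derivC derivZ derivX alg_polyC.
- by rewrite dxD dyD !sliceD derivD IHf IHg scalerDr opprD addrACA.
rewrite dxM dyM (sliceM f) (sliceD (dx f * g)) (sliceD (dy f * g)).
rewrite (sliceM (dx f)) (sliceM f) (sliceM (dy f)) (sliceM f) derivM IHf IHg.
rewrite -!mul_polyC; exact: mul_derivation.
Qed.

Lemma slice_size f s w : (size (slice f s w) <= mmeasure mdeg f)%N.
Proof.
rewrite /slice /mmap; apply: (leq_trans (size_sum _ _ _)).
apply/bigmax_leqP_seq => m mf _; apply: leq_trans (msize_mdeg_lt mf).
rewrite mul_polyC; apply: (leq_trans (size_scale_leq _ _)).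
rewrite /mmap1 big_ord_recl big_ord1 /pt /= mdegE big_ord_recl big_ord1.
apply: (leq_trans (size_polyMleq _ _)); rewrite size_polyXn addSn /= -addnS leq_add2l.
have -> : w%:P - s *: 'X = (- s) *: 'X + w%:P by rewrite scaleNr addrC.
have sz : (size ((- s) *: 'X + w%:P)%R <= 2)%N.
  apply: (leq_trans (size_polyD _ _)); rewrite geq_max (leq_trans (size_scale_leq _ _)) ?size_polyX //.
  by rewrite (leq_trans (size_polyC_leq1 _)).
apply: (leq_trans (size_poly_exp_leq _ _)); rewrite ltnS -[leqRHS]mul1n leq_mul2r.
by apply/orP; right; case: (size _) sz => [|[|[|]]].
Qed.

Lemma slice0_deriv_horner f s x : (slice f s 0)^`().[x] =
  \sum_(m <- msupp f)
     mcoeff m f * (- s) ^+ m 1 * (mdeg m)%:R * x ^+ (mdeg m).-1.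
Proof.
rewrite /slice /mmap raddf_sum -horner_evalE rmorph_sum; apply: eq_bigr => m _ /=.
rewrite /mmap1 big_ord_recl big_ord1 /pt /= sub0r -scaleNr exprZn.
rewrite -scalerAr -exprD mul_polyC scalerA derivZ derivXn horner_evalE hornerZ.
have -> : mdeg m = (m 0%R + m 1%R)%N by rewrite mdegE big_ord_recl big_ord1; congr (_ + m _)%N; apply/val_inj.
have -> : lift ord0 ord0 = 1 :> 'I_2 by apply/val_inj.
by rewrite hornerMn hornerXn [RHS]mulrAC mulr_natr mulrnAr; congr (_ *+ _).
Qed.

Lemma ev00 f : ev f 0 0 = mcoeff mnm0 f.
Proof.
have h0 m : m != mnm0 -> \prod_i pt (0 : C) 0 i ^+ m i = 0.
  move=> m0; case: (pickP (fun i => m i != 0%N)) => [i mi|mz].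
    by rewrite (bigD1 i) //= /pt if_same expr0n (negPf mi) mul0r.
  by case/eqP: m0; apply/mnmP => i; rewrite mnm0E; have /negbFE/eqP := mz i.
rewrite /ev mevalE; have [m0f|m0f] := boolP (mnm0 \in msupp f); last first.
  move: (m0f); rewrite -mcoeff_eq0 => /eqP->.
  rewrite big1_seq // => m /= mf; rewrite h0 ?mulr0 //.
  by apply: contraNneq m0f => <-.
rewrite (bigD1_seq mnm0) ?msupp_uniq //= [X in _ + X]big1_seq => [|m /andP[m0 mf]].
  by rewrite addr0 big1 ?mulr1 // => i _; rewrite mnm0E expr0.
by rewrite h0 ?mulr0.
Qed.

(** The line s x + y = 0 passes through the origin, and the least degree k + 1
    of the monomials of [f] gives the leading term of [f] there: it is
    b(s) x^(k+1), where b(s) = F(1, - s) for the homogeneous part F of degree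
    k + 1. *)
Lemma lowest_form f : f != 0 -> ev f 0 0 = 0 ->
  exists k, exists2 b : {poly C}, b != 0 & forall delta : R,
    exists2 B, 0 < B & forall s x, absc s <= delta -> absc x <= 1 ->
      absc ((slice f s 0)^`().[x] - k.+1%:R * b.[s] * x ^+ k) <= B * absc x ^+ k.+1.
Proof.
move=> f0 f00; have exm : exists j, has (fun m => mdeg m == j) (msupp f).
  have : msupp f != [::] by rewrite msupp_eq0.
  by case: (msupp f) => // m r _; exists (mdeg m); rewrite /= eqxx.
case: (ex_minnP exm) => -[|k].
  move=> /hasP[m mf]; rewrite mdeg_eq0 => /eqP m0 _; exfalso.
  by move: mf; rewrite m0 -[_ \in _]negbK -mcoeff_eq0 -ev00 f00 eqxx.
move=> /hasP[m0 m0f /eqP m0k] kmin; exists k.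
pose b : {poly C} := \sum_(m <- msupp f | mdeg m == k.+1) (mcoeff m f * (- 1) ^+ m 1) *: 'X^(m 1).
exists b.
  apply/eqP => /(congr1 (fun p : {poly C} => p`_(m0 1))) /eqP; rewrite coef0 coef_sum.
  rewrite big_mkcond (bigD1_seq m0) ?msupp_uniq //= m0k eqxx coefZ coefXn eqxx mulr1.
  rewrite [X in _ + X]big1_seq => [|m /andP[mm0 mf]].
    by rewrite addr0 mulf_eq0 signr_eq0 orbF mcoeff_eq0 m0f.
  case: eqP => // mk; rewrite coefZ coefXn; case: eqP => [m1|_]; last by rewrite mulr0.
  case/eqP: mm0; apply/mnmP => i; have : m 0 = m0 0.
    have := m0k; rewrite -mk !mdegE !big_ord_recl !big_ord0 !addn0.
    have -> : lift ord0 ord0 = 1 :> 'I_2 by apply/val_inj.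
    by rewrite m1 => /eqP; rewrite eqn_add2r => /eqP.
  case: i => [[|[|//]]] i2 m00.
    by have -> : Ordinal i2 = 0 by apply/val_inj.
  by have -> : Ordinal i2 = 1 by apply/val_inj.
move=> delta; exists (1 + \sum_(m <- msupp f) absc (mcoeff m f) * `|delta| ^+ m 1 * (mdeg m)%:R).
  by rewrite ltr_wpDr // sumr_ge0 // => m _; rewrite !mulr_ge0 ?absc_ge0 ?exprn_ge0.
move=> s x hs hx.
have -> : k.+1%:R * b.[s] * x ^+ k = \sum_(m <- msupp f | mdeg m == k.+1)
     mcoeff m f * (- s) ^+ m 1 * (mdeg m)%:R * x ^+ (mdeg m).-1.
  rewrite /b -horner_evalE rmorph_sum mulr_sumr mulr_suml; apply: eq_bigr => m /eqP-> /=.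
  by rewrite horner_evalE hornerZ hornerXn [(- s) ^+ _]exprNn; ring.
rewrite slice0_deriv_horner (bigID (fun m => mdeg m == k.+1)) /= addrAC subrr add0r.
apply: (le_trans (absc_sum _ _ _)); rewrite mulrDl mul1r mulr_suml.
rewrite ler_wpDl ?exprn_ge0 ?absc_ge0 // [leRHS](bigID (fun m => mdeg m == k.+1)) /=.
rewrite ler_wpDl //.
  by apply: sumr_ge0 => m _; rewrite !mulr_ge0 ?absc_ge0 ?exprn_ge0 ?absc_ge0.
rewrite big_seq_cond [leRHS]big_seq_cond; apply: ler_sum => m /andP[mf mk].
have km : (k.+1 < mdeg m)%N.
  rewrite ltn_neqAle eq_sym mk /= kmin //; apply/hasP; exists m => //.
rewrite !abscM !abscX abscN absc_nat -!mulrA ler_wpM2l ?absc_ge0 // ler_pM ?mulr_ge0 ?exprn_ge0 ?absc_ge0 //.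
  by rewrite lerXn2r ?nnegrE ?absc_ge0 // (le_trans hs) // ler_norm.
rewrite ler_wpM2l // ler_wiXn2l ?absc_ge0 //.
by case: (mdeg m) km.
Qed.

End Bivariate.

(** * An algebraic relation between a polynomial and its derivatives *)

Lemma dependent_family (F : fieldType) (I J : finType) (u : I -> J -> F) :
  (#|J| < #|I|)%N ->
  exists2 a : I -> F, exists i, a i != 0 & forall j, \sum_i a i * u i j = 0.
Proof.
move=> ltJI; pose M : 'M[F]_(#|I|, #|J|) := \matrix_(i, j) u (enum_val i) (enum_val j).
have : kermx M != 0.
  by rewrite -mxrank_eq0 mxrank_ker -lt0n subn_gt0 (leq_ltn_trans (rank_leq_col M)).
case/rowV0Pn => v /sub_kermxP vM v0; exists (fun i => v 0 (enum_rank i)).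
  have [i vi|v00] := pickP (fun i => v 0 i != 0).
    by exists (enum_val i); rewrite enum_valK.
  by case/eqP: v0; apply/rowP => i; rewrite mxE; have /negbFE/eqP := v00 i.
move=> j; move/matrixP/(_ 0 (enum_rank j)): vM; rewrite !mxE => vM.
rewrite -[RHS]vM [LHS](reindex (@enum_val I predT)) /=; last exact: onW_bij (enum_val_bij I).
by apply: eq_bigr => i _; rewrite !mxE enum_valK enum_rankK.
Qed.

(** Exponents of the monomials of degree < n in two variables; as dependent
    pairs, so that their number is read off as a sum. *)
Definition triangle (n : nat) : finType := {i : 'I_n & 'I_(n - i)}.

Lemma card_triangle n : (#|triangle n|.*2 = n * n.+1)%N.
Proof.
rewrite card_tagged sumnE big_map big_enum /=.
under eq_bigr => i _ do rewrite card_ord.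
elim: n => [|n IH]; first by rewrite big_ord0.
rewrite big_ord_recl doubleD subn0.
under eq_bigr => i _ do rewrite subSS.
by rewrite IH -mul2n -mulnDl mulnC.
Qed.

Section Relation.
Variable R : realType.
Local Notation C := (complex R).
Local Notation MP := (mpoly 2 C).
Implicit Types (f p q : MP).

Lemma msize_mul_le f p a b : (mmeasure mdeg f <= a.+1)%N -> (mmeasure mdeg p <= b.+1)%N ->
  (mmeasure mdeg (f * p) <= (a + b).+1)%N.
Proof.
have [->|f0] := eqVneq f 0; first by rewrite mul0r mmeasure0.
have [->|p0] := eqVneq p 0; first by rewrite mulr0 mmeasure0.
by rewrite msizeM //; move: (mmeasure _ f) (mmeasure _ p) => u v; lia.
Qed.

Lemma msize_exp_le f a k : (mmeasure mdeg f <= a.+1)%N ->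
  (mmeasure mdeg (f ^+ k) <= (a * k).+1)%N.
Proof.
move=> fa; elim: k => [|k IH]; first by rewrite expr0 msize1.
by rewrite exprS mulnS msize_mul_le.
Qed.

(** The number of triples (k, i, j) with k <= e^2 and i + j < D grows like
    (e^2 + 1) D^2 / 2, the number of monomials of degree at most
    (e + 1) e^2 + D e like e^2 D^2 / 2. *)
Lemma relations_outnumber_monomials (e : nat) : exists D : nat,
  ((e ^ 2 * e.+1 + D * e).+1 * (e ^ 2 * e.+1 + D * e).+2 < (e ^ 2).+1 * (D * D.+1))%N.
Proof.
exists ((2 * e).+1 * ((e ^ 2 * e.+1).+2))%N.
move: (e ^ 2 * e.+1)%N => K; pose D := ((2 * e).+1 * K.+2)%N; rewrite -/D.
have DE : D = ((2 * e).+1 * K.+2)%N by []; clearbody D.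
have h1 : (D * D = 2 * e * K.+2 * D + K.+2 * D)%N by rewrite {1}DE; ring.
have h2 : (K.+2 <= D)%N by rewrite DE mulSn leq_addr.
have h3 : (K.+2 * K.+2 <= K.+2 * D)%N by rewrite leq_mul2l h2 orbT.
have h4 : ((K + D * e).+1 * (K + D * e).+2 <= (D * e + K.+2) * (D * e + K.+2))%N.
  by rewrite leq_mul // addnC; lia.
have h5 : ((D * e + K.+2) * (D * e + K.+2) = e ^ 2 * (D * D) + 2 * e * K.+2 * D + K.+2 * K.+2)%N.
  by ring.
have h6 : ((e ^ 2).+1 * (D * D.+1) = e ^ 2 * (D * D) + D * D + (e ^ 2).+1 * D)%N.
  by ring.
have h7 : (0 < (e ^ 2).+1 * D)%N by rewrite muln_gt0 /= (leq_trans _ h2).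
by rewrite h6; apply: (leq_ltn_trans h4); rewrite h5 h1; move: h3 h7; lia.
Qed.

(** There are more products f^k p^i q^j with k <= e^2 and i + j < D than
    monomials to express them.  The bound that matters is the one on the
    degree in [f]. *)
Lemma algebraic_relation f p q e :
  (mmeasure mdeg f <= e.+2)%N -> (mmeasure mdeg p <= e.+1)%N -> (mmeasure mdeg q <= e.+1)%N ->
  exists D (a : 'I_(e ^ 2).+1 * triangle D -> C), (exists i, a i != 0) /\
    \sum_i a i *: (f ^+ i.1 * (p ^+ tag i.2 * q ^+ tagged i.2)) = 0.
Proof.
move=> hf hp hq; have [D hD] := relations_outnumber_monomials e; exists D.
pose E := (e ^ 2 * e.+1 + D * e)%N.
pose mon (t : triangle E.+1) := Multinom [tuple (tag t : nat); (tagged t : nat)].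
pose v (i : 'I_(e ^ 2).+1 * triangle D) := f ^+ i.1 * (p ^+ tag i.2 * q ^+ tagged i.2).
have vsz i : (mmeasure mdeg (v i) <= E.+1)%N.
  case: i => k [i j]; rewrite /v /=.
  have := msize_mul_le (msize_exp_le k hf) (msize_mul_le (msize_exp_le i hp) (msize_exp_le j hq)).
  move/leq_trans; apply; rewrite ltnS /E leq_add //.
    by rewrite mulnC leq_mul2r -ltnS ltn_ord orbT.
  by rewrite -mulnDr mulnC leq_mul2r; apply/orP; right; have := ltn_ord j; lia.
have [|a a0 ha] := @dependent_family C _ (triangle E.+1) (fun i t => mcoeff (mon t) (v i)).
  by rewrite card_prod card_ord -ltn_double doubleMr !card_triangle.
exists a; split=> //; apply/mpolyP => m; rewrite mcoeff0.
have [mE|mE] := ltnP (mdeg m) E.+1; last first.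
  rewrite raddf_sum big1 // => i _; apply/eqP.
  by rewrite /= mcoeffZ mulf_eq0 mcoeff_eq0 msize_mdeg_ge ?orbT // (leq_trans (vsz i)).
have mdE : mdeg m = (m 0%R + m 1%R)%N.
  by rewrite mdegE big_ord_recl big_ord1; congr (_ + m _)%N; apply/val_inj.
have m0 : (m 0%R < E.+1)%N by rewrite (leq_ltn_trans _ mE) // mdE leq_addr.
have m1 : (m 1%R < E.+1 - Ordinal m0)%N by rewrite ltn_subRL /= -mdE.
pose t : triangle E.+1 := Tagged (fun i : 'I_E.+1 => 'I_(E.+1 - i)) (Ordinal m1).
have -> : m = mon t.
  apply/mnmP => -[[|[|//]]] i2; rewrite multinomE (tnth_nth 0%N) /=; congr (m _); exact/val_inj.
rewrite -[RHS](ha t) raddf_sum; apply: eq_bigr => i _; exact: mcoeffZ.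
Qed.

(** Substitute p = s q and T = t q.  Among the terms of the relation, those of
    least total degree m and, among them, of least degree k0 in T contribute
    q^m t^k0 B(s); the other terms of total degree m carry at least one more
    factor t, the terms of higher total degree at least one more factor q.  When
    |B(s)| >= c and |t| <= e0 this yields (c / 2) |t|^k0 <= S |q|, and
    k0 <= N. *)
Lemma small_ratio_gap (I : finType) (a : I -> C) (k i j : I -> nat) (N : nat) :
  injective (fun t => (k t, i t, j t)) -> (exists t, a t != 0) ->
  (forall t, k t <= N)%N ->
  exists2 B : {poly C}, B != 0 & forall delta c : R, 0 < c ->
    (forall s, absc s = delta -> c <= absc B.[s]) ->
    exists e0 M, [/\ 0 < e0, 0 < M & forall s q T : C, absc s = delta ->
      0 < absc q -> absc q <= 1 -> absc T <= e0 * absc q ->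
      \sum_t a t * (T ^+ k t * ((s * q) ^+ i t * q ^+ j t)) = 0 ->
      absc T ^+ N <= M * absc q ^+ N.+1].
Proof.
move=> kij_inj a0 kN; pose tot t := (k t + (i t + j t))%N.
have exm : exists m, [exists t, (a t != 0) && (tot t == m)].
  by case: a0 => t ta; exists (tot t); apply/existsP; exists t; rewrite ta eqxx.
case: (ex_minnP exm) => m /existsP[t1 /andP[t1a /eqP t1m]] mmin.
have exk : exists k0, [exists t, [&& a t != 0, tot t == m & k t == k0]].
  by exists (k t1); apply/existsP; exists t1; rewrite t1a t1m !eqxx.
case: (ex_minnP exk) => k0 /existsP[t0 /and3P[t0a /eqP t0m /eqP t0k]] kmin.
pose main t := (tot t == m) && (k t == k0).
pose B : {poly C} := \sum_(t | main t) a t *: 'X^(i t).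
exists B.
  apply/eqP => /(congr1 (fun p : {poly C} => p`_(i t0))) /eqP; rewrite coef0 coef_sum.
  rewrite (bigD1 t0) /=; last by rewrite /main t0m t0k !eqxx.
  rewrite [X in _ + X]big1 => [|t /andP[/andP[/eqP tm /eqP tk] tt0]].
    by rewrite addr0 coefZ coefXn eqxx mulr1 (negPf t0a).
  rewrite coefZ coefXn; case: eqP => [it|_]; last by rewrite mulr0.
  case/eqP: tt0; apply: kij_inj; move: tm t0m; rewrite /tot tk t0k it => tm t0m.
  by congr (_, _, _); lia.
move=> delta c c0 hB; pose S := 1 + \sum_t absc (a t) * `|delta| ^+ i t.
have S0 : 0 < S by rewrite ltr_wpDr // sumr_ge0 // => t _; rewrite mulr_ge0 ?absc_ge0 ?exprn_ge0.
exists (Num.min 1 (c / (2 * S))), (2 * S / c); split.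
- by rewrite lt_min ltr01 divr_gt0 ?mulr_gt0.
- by rewrite divr_gt0 ?mulr_gt0.
move=> s q T hs q0 q1 hT.
have qn0 : q != 0 by rewrite -absc_gt0.
have [e TE] : exists e, T = e * q by exists (T / q); rewrite mulfVK.
have {hT} : absc e <= Num.min 1 (c / (2 * S)) by rewrite -(ler_pM2r q0) -abscM -TE.
rewrite le_min => /andP[e1 e2] rel.
have e_ge0 := absc_ge0 e; have q_ge0 := ltW q0.
have key : absc B.[s] * absc e ^+ k0 <= S * (absc e ^+ k0.+1 + absc q).
  have : \sum_t a t * (e ^+ k t * s ^+ i t * q ^+ (tot t - m)) = 0.
    apply/eqP; rewrite -(inj_eq (mulIf (expf_neq0 m qn0))) mul0r -[X in _ == X]rel mulr_suml.
    apply/eqP; apply: eq_bigr => t _; have [->|ta] := eqVneq (a t) 0; first by rewrite !mul0r.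
    rewrite TE !exprMn -!mulrA; congr (_ * _).
    have mt : (m <= tot t)%N by apply: mmin; apply/existsP; exists t; rewrite ta /=.
    by rewrite -exprD subnK // /tot !exprD; ring.
  rewrite (bigID main) /= => /eqP; rewrite addr_eq0 => /eqP E.
  have -> : absc B.[s] * absc e ^+ k0 = absc (\sum_(t | main t) a t * (e ^+ k t * s ^+ i t * q ^+ (tot t - m))).
    rewrite -abscX -abscM /B -horner_evalE rmorph_sum mulr_suml; congr absc.
    apply: eq_bigr => t /andP[/eqP-> /eqP->] /=.
    by rewrite subnn expr0 mulr1 horner_evalE hornerZ hornerXn; ring.
  rewrite E abscN; apply: (le_trans (absc_sum _ _ _)); rewrite mulrDl mul1r.
  rewrite ler_wpDl ?addr_ge0 ?exprn_ge0 // mulr_suml [leRHS](bigID main) /= ler_wpDl //.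
    by apply: sumr_ge0 => t _; rewrite !mulr_ge0 ?addr_ge0 ?exprn_ge0 ?absc_ge0.
  apply: ler_sum => t tmain; have [->|ta] := eqVneq (a t) 0; first by rewrite mul0r absc0 !mul0r.
  rewrite !abscM !abscX hs -!mulrA ler_wpM2l ?absc_ge0 // mulrCA.
  rewrite ler_pM ?mulr_ge0 ?exprn_ge0 //.
    by rewrite -hs absc_ge0.
    by rewrite lerXn2r ?nnegrE // -?hs ?absc_ge0 // ler_norm.
  have mt : (m <= tot t)%N by apply: mmin; apply/existsP; exists t; rewrite ta /=.
  have [tm|tm] := eqVneq (tot t) m.
    rewrite tm subnn expr0 mulr1 ler_wpDr // ler_wiXn2l //.
    rewrite ltn_neqAle kmin ?andbT; last by apply/existsP; exists t; rewrite ta tm !eqxx.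
    by move: tmain; rewrite /main tm eqxx /= eq_sym.
  rewrite ler_wpDl ?exprn_ge0 // -[leRHS]mul1r ler_pM ?exprn_ge0 ?exprn_ile1 //.
  rewrite -[leRHS]expr1 ler_wiXn2l //.
  by rewrite subn_gt0 ltn_neqAle eq_sym tm.
have Bs := hB s hs; have ek0 : 0 <= absc e ^+ k0 by rewrite exprn_ge0.
have h1 : c * absc e ^+ k0 <= absc B.[s] * absc e ^+ k0 by rewrite ler_wpM2r.
have h2 : S * absc e ^+ k0.+1 <= c / 2 * absc e ^+ k0.
  rewrite exprS mulrA ler_wpM2r //.
  move: e2; rewrite ler_pdivlMr ?mulr_gt0 //; lra.
have h3 : absc e ^+ k0 <= 2 * S / c * absc q.
  rewrite mulrAC ler_pdivlMr //; lra.
rewrite TE abscM exprMn exprS mulrA ler_wpM2r ?exprn_ge0 //.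
by apply: le_trans h3; rewrite ler_wiXn2l // -t0k.
Qed.

End Relation.

(** * Walking along a polar curve to the origin *)

Lemma split_increment (K : comNzRingType) (a b c d : K) :
  d = a + (b + ((c - a - b) + (d - c))).
Proof. by ring. Qed.

Section WalkArithmetic.
Variable R : realType.

Lemma half_le_loss (e0 t : R) : 0 < e0 -> t <= e0 / 4 -> 2^-1 <= 1 - 2 * t / e0.
Proof.
move=> e0_gt0 te; have : 2 * t / e0 <= 1 / 2 by rewrite ler_pdivrMr //; lra.
by lra.
Qed.

Lemma loss_add (u v : R) : 0 <= u -> 0 <= v -> 1 - (u + v) <= (1 - u) * (1 - v).
Proof. by move=> u0 v0; have := mulr_ge0 u0 v0; lra. Qed.

Lemma step_loss (e0 F0 F h a b c : R) : 0 < e0 -> 0 <= h -> F0 / 2 <= F ->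
  a <= F / e0 * h -> b <= F0 / (4 * e0) * h -> c <= F0 / (4 * e0) * h ->
  F * (1 - 2 * h / e0) <= F - (a + (b + c)).
Proof.
move=> e0_gt0 h0 F0F ha hb hc.
have h1 : F0 / (4 * e0) * h + F0 / (4 * e0) * h = F0 / 2 * (h / e0) by field; lra.
have h2 : F0 / 2 * (h / e0) <= F * (h / e0) by rewrite ler_wpM2r // divr_ge0 // ltW.
have -> : F * (1 - 2 * h / e0) = F - (F * (h / e0) + F * (h / e0)) by ring.
have h3 : F / e0 * h = F * (h / e0) by rewrite mulrAC -mulrA.
lra.
Qed.

Lemma ratio_kept (e0 F0 F F' q q' u : R) : 0 < e0 -> F0 / 2 <= F -> e0 * q <= F ->
  3 / 4 * F <= F' -> q' <= q + u -> e0 / 2 * u <= F0 / 8 -> e0 / 2 * q' <= F'.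
Proof.
move=> e0_gt0 F0F qF FF' qq' hu.
have : e0 / 2 * q' <= e0 / 2 * (q + u) by rewrite ler_wpM2l // divr_ge0 // ltW.
lra.
Qed.

End WalkArithmetic.

Section Walk.
Variables (R : realType) (f : mpoly 2 (complex R)).
Local Notation C := (complex R).
Implicit Types (s x w : C).

Let F s x w := ev f x (w - s * x).
Let Q s x w := ev (dy f) x (w - s * x).
Let G s x w := (slice f s w)^`().[x].

Variables (n : nat) (delta eps w1 e0 c0 LG Lq Lt : R).
Hypotheses (f_size : (mmeasure mdeg f <= n.+1)%N).
Hypotheses (delta0 : 0 <= delta) (eps0 : 0 < eps) (e0_gt0 : 0 < e0) (c0_gt0 : 0 < c0).
Hypotheses (LG0 : 0 < LG) (Lq0 : 0 < Lq) (Lt0 : 0 < Lt).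
Hypothesis stay : forall s x w, absc s = delta -> absc x <= eps -> absc w <= w1 ->
  G s x w = 0 -> absc x <= eps / 2.
Hypothesis G_far : forall s w, absc s = delta -> absc w <= w1 -> c0 <= absc (G s eps%:C%C w).
Hypothesis G_lip : forall s x w w', absc s = delta -> absc x <= eps ->
  absc w <= w1 -> absc w' <= w1 -> absc (G s x w' - G s x w) <= LG * absc (w' - w).
Hypothesis Q_lip : forall s x w x' w', absc s = delta -> absc x <= eps -> absc x' <= eps ->
  absc w <= w1 -> absc w' <= w1 ->
  absc (Q s x' w' - Q s x w) <= Lq * ((1 + delta) * absc (x' - x) + absc (w' - w)).
Hypothesis F_taylor : forall s x w w', absc s = delta -> absc x <= eps ->
  absc w <= w1 -> absc w' <= w1 ->
  absc (F s x w' - F s x w - Q s x w * (w' - w)) <= Lt * absc (w' - w) ^+ 2.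
Hypothesis F_gap : forall s x w, absc s = delta -> absc x <= eps -> absc w <= w1 ->
  G s x w = 0 -> Q s x w != 0 -> absc (F s x w) <= e0 * absc (Q s x w) ->
  absc (F s x w) < e0 / 2 * absc (Q s x w).

(** One step of the walk.  The slice at w' has derivative O(h) at [x], where
    h = |w' - w|, because the slice at [w] has derivative 0 there.  Hence its
    nearest critical point [x'] is at a distance rho that is small with [h], and
    F changes by Q (w' - w) + O(rho h) + O(h^2).  Since |Q| <= |F| / e0, the loss
    is at most 2 |F| h / e0 once [h] is small enough; by continuity of Q the new
    point satisfies |F| >= (e0 / 2) |Q|, and the gap improves e0 / 2 to e0.  The
    bound h0 depends on the size F0 of F only, so that the steps can be
    repeated. *)
Lemma walk_step (F0 : R) : 0 < F0 -> exists2 h0 : R, 0 < h0 &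
  forall s x w w', absc s = delta -> absc x <= eps / 2 -> absc w <= w1 -> absc w' <= w1 ->
    absc (w' - w) <= h0 -> G s x w = 0 -> F0 / 2 <= absc (F s x w) ->
    e0 * absc (Q s x w) <= absc (F s x w) ->
    exists x', [/\ absc x' <= eps / 2, G s x' w' = 0,
      absc (F s x w) * (1 - 2 * absc (w' - w) / e0) <= absc (F s x' w') &
      e0 * absc (Q s x' w') <= absc (F s x' w')].
Proof.
move=> F0_gt0; have ep := eps0; have e0p := e0_gt0; have c0p := c0_gt0.
have LGp := LG0; have Lqp := Lq0; have Ltp := Lt0; pose K := 1 + n%:R * 2 ^+ n * LG.
have K0 : 0 < K by rewrite ltr_wpDr // !mulr_ge0 ?exprn_ge0 ?(ltW LG0).
have d1 : 0 < 1 + delta by rewrite ltr_wpDr.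
(* The distance [eta] to the new root is fixed before [h0], which must be small compared with it. *)
pose eta := Num.min (eps / 2) (Num.min (F0 / (4 * e0 * K)) (F0 / (8 * e0 * (Lq * (1 + delta))))).
have eta0 : 0 < eta by rewrite !lt_min !divr_gt0 ?mulr_gt0.
pose A := (2 * eps / eta + 1) ^+ n.
have A1 : 1 <= A by rewrite exprn_ege1 // lerDr divr_ge0 ?mulr_ge0 ?(ltW eps0) ?(ltW eta0).
have A0 : 0 < A by rewrite (lt_le_trans ltr01).
pose h0 := Num.min (Num.min (e0 / 8) (F0 / (4 * e0 * Lt)))
                   (Num.min (F0 / (8 * e0 * Lq)) (c0 / (2 * LG * A))).
exists h0; first by rewrite !lt_min !divr_gt0 ?mulr_gt0.
move=> s x w w' hs hx hw hw'; set h := absc (w' - w); rewrite !le_min.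
move=> /andP[/andP[hh1 hh2] /andP[hh3 hh4]] Gx Fx Qx.
have h_ge0 : 0 <= h := absc_ge0 _.
have hx' : absc x <= eps by lra.
have Gh : absc (G s x w') <= LG * h.
  by have := G_lip hs hx' hw hw'; rewrite Gx subr0.
have Gh_lt : A * (LG * h) < c0.
  move: hh4; rewrite ler_pdivlMr ?mulr_gt0 // => hh4.
  have : 0 <= A * (LG * h) by rewrite !mulr_ge0 // ltW.
  by lra.
have Gh_lt1 : LG * h < c0.
  by apply: le_lt_trans Gh_lt; rewrite ler_peMl ?mulr_ge0 ?(ltW LG0).
have Gnc : (1 < size (slice f s w')^`())%N.
  rewrite ltnNge; apply/negP => /size1_polyC Gc; have := G_far hs hw'.
  by move: Gh; rewrite /G Gc !hornerC => g1 g2; have := le_lt_trans (le_trans g2 g1) Gh_lt1; rewrite ltxx.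
have [x' [Gx' dF far]] := nearest_critical x (leq_trans (slice_size f s w') f_size) Gnc.
set rho := absc (x' - x) in dF far.
have rho_ge0 : 0 <= rho := absc_ge0 _.
have rho_eta : rho < eta.
  rewrite ltNge; apply/negP => /(far eps%:C%C _ eta0) hfar.
  have := G_far hs hw'; rewrite leNgt => /negP; apply; apply: le_lt_trans hfar _.
  apply: le_lt_trans Gh_lt; rewrite ler_pM ?absc_ge0 ?exprn_ge0 //.
    by rewrite addr_ge0 // divr_ge0 ?absc_ge0 // ltW.
  rewrite lerXn2r ?nnegrE ?addr_ge0 ?divr_ge0 ?absc_ge0 ?mulr_ge0 ?(ltW eta0) ?(ltW eps0) //.
  rewrite lerD2r ler_wpM2r ?invr_ge0 ?(ltW eta0) //.
  by apply: (le_trans (absc_leB _ _)); rewrite absc_real ger0_norm ?ltW //; lra.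
move: (rho_eta); rewrite !lt_min => /andP[rho1 /andP[rho2 rho3]].
have x'eps : absc x' <= eps.
  by have := absc_leD (x' - x) x; rewrite subrK -/rho; lra.
have G0 : G s x' w' = 0 by apply/eqP.
have F_lb : absc (F s x w) * (1 - 2 * h / e0) <= absc (F s x' w').
  have -> : F s x' w' = F s x w + (Q s x w * (w' - w)
      + ((F s x w' - F s x w - Q s x w * (w' - w)) + (F s x' w' - F s x w'))).
    exact: split_increment.
  have e1 : absc (F s x' w' - F s x w') <= F0 / (4 * e0) * h.
    move: dF; rewrite !slice_horner -/(F s x' w') -/(F s x w') => dF.
    apply: (le_trans dF); apply: (@le_trans _ _ (n%:R * 2 ^+ n * rho * (LG * h))).
      by rewrite ler_wpM2l // !mulr_ge0 ?exprn_ge0.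
    have -> : n%:R * 2 ^+ n * rho * (LG * h) = (n%:R * 2 ^+ n * LG) * rho * h by ring.
    rewrite ler_wpM2r //; apply: (@le_trans _ _ (K * rho)).
      by rewrite ler_wpM2r // lerDr.
    move: rho2; rewrite !ltr_pdivlMr ?mulr_gt0 // => rho2.
    by rewrite ler_pdivlMr ?mulr_gt0 //; lra.
  have e2 := F_taylor hs hx' hw hw'; rewrite -/h expr2 in e2.
  have e3 : Lt * (h * h) <= F0 / (4 * e0) * h.
    rewrite mulrA ler_wpM2r // ler_pdivlMr ?mulr_gt0 //.
    by move: hh2; rewrite ler_pdivlMr ?mulr_gt0 //; lra.
  have e4 : absc (Q s x w * (w' - w)) <= absc (F s x w) / e0 * h.
    by rewrite abscM -/h ler_wpM2r // ler_pdivlMr // mulrC.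
  apply: le_trans (absc_geD _ _).
  apply: le_trans (step_loss e0_gt0 h_ge0 Fx e4 (le_trans e2 e3) e1) _.
  rewrite lerD2l lerN2 (le_trans (absc_leD _ _)) // lerD2l.
  exact: absc_leD.
exists x'; split=> //; first exact: stay G0.
rewrite leNgt; apply/negP => lt_FQ.
have Q0 : Q s x' w' != 0.
  by apply: contraTneq lt_FQ => ->; rewrite absc0 mulr0 -leNgt absc_ge0.
have := F_gap hs x'eps hw' G0 Q0 (ltW lt_FQ); rewrite ltNge => /negP; apply.
have F34 : 3 / 4 * absc (F s x w) <= absc (F s x' w').
  apply: le_trans F_lb; rewrite mulrC ler_wpM2l ?absc_ge0 //.
  have : 2 * h / e0 <= 1 / 4 by rewrite ler_pdivrMr //; lra.
  by lra.
have q1 := Q_lip hs hx' x'eps hw hw'; rewrite -/h -/rho in q1.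
have q2 := absc_leD (Q s x w) (Q s x' w' - Q s x w); rewrite subrKC in q2.
have q3 : e0 / 2 * (Lq * ((1 + delta) * rho)) <= F0 / 16.
  rewrite ltr_pdivlMr ?mulr_gt0 // in rho3; move: rho3; set t := Lq * (1 + delta) => rho3.
  have -> : e0 / 2 * (Lq * ((1 + delta) * rho)) = rho * (8 * e0 * t) / 16 by rewrite /t; field.
  by rewrite ler_wpM2r ?invr_ge0 // ltW.
have q4 : e0 / 2 * (Lq * h) <= F0 / 16.
  rewrite ler_pdivlMr ?mulr_gt0 // in hh3.
  have -> : e0 / 2 * (Lq * h) = h * (8 * e0 * Lq) / 16 by field.
  by rewrite ler_wpM2r ?invr_ge0.
apply: ratio_kept e0_gt0 Fx Qx F34 (le_trans q2 (lerD (lexx _) q1)) _.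
have -> : F0 / 8 = F0 / 16 + F0 / 16 by field.
by rewrite [Lq * _]mulrDr mulrDr lerD.
Qed.

Hypothesis F00 : F 0 0 0 = 0.
Hypothesis G_isolated : forall s x, absc s = delta -> absc x <= eps -> G s x 0 = 0 -> x = 0.

(** Otherwise M equal steps lead from [w] to 0 and multiply |F| by at least
    1 - 2 |w| / e0 >= 1 / 2; but the only critical point near 0 of the slice at 0
    is the origin, where F vanishes. *)
Lemma walk s x w : absc s = delta -> absc x <= eps / 2 -> absc w <= w1 -> absc w <= e0 / 4 ->
  G s x w = 0 -> F s x w != 0 -> absc (F s x w) < e0 * absc (Q s x w).
Proof.
move=> hs hx hw hwe Gx Fx; rewrite ltNge; apply/negP => FQ.
have e0p := e0_gt0; have epsp := eps0.
have F0 : 0 < absc (F s x w) by rewrite absc_gt0.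
have [h0 h0_gt0 hstep] := walk_step F0.
have w0 := absc_ge0 w.
(* The number of steps is such that each has length at most [h0]. *)
pose M := (Num.truncn (absc w / h0)).+1.
have M0 : 0 < M%:R :> R by rewrite ltr0n.
have hM : absc w / M%:R <= h0.
  rewrite ler_pdivrMr // mulrC -ler_pdivrMr // ltW //.
  by have /andP[] := truncn_itv (divr_ge0 w0 (ltW h0_gt0)).
set h := absc w / M%:R in hM.
have h_ge0 : 0 <= h by rewrite divr_ge0 // ltW.
pose t k : C := ((M%:R - k%:R) / M%:R : R)%:C%C.
have tw1 k : (k <= M)%N -> absc (t k * w) <= absc w.
  move=> kM; rewrite abscM absc_real ger0_norm.
    rewrite ler_piMl // ler_pdivrMr // mul1r lerBlDr lerDl //.
  by rewrite divr_ge0 ?(ltW M0) // subr_ge0 ler_nat.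
have tstep k : absc (t k.+1 * w - t k * w) = h.
  rewrite -mulrBl abscM /t -rmorphB absc_real.
  have -> : (M%:R - k.+1%:R) / M%:R - (M%:R - k%:R) / M%:R = - (M%:R)^-1 :> R.
    by rewrite -natr1; ring.
  by rewrite normrN ger0_norm ?invr_ge0 ?(ltW M0) // mulrC.
have claim k : (k <= M)%N -> exists xk, [/\ absc xk <= eps / 2, G s xk (t k * w) = 0,
    absc (F s x w) * (1 - 2 * (k%:R * h) / e0) <= absc (F s xk (t k * w)) &
    e0 * absc (Q s xk (t k * w)) <= absc (F s xk (t k * w))].
  elim: k => [|k IH] kM.
    have -> : t 0%N * w = w by rewrite /t subr0 divff ?gt_eqF // mul1r.
    by exists x; split=> //; rewrite mul0r mulr0 mul0r subr0 mulr1.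
  have [xk [hxk Gk Fk Qk]] := IH (ltnW kM).
  have kh : k%:R * h <= e0 / 4.
    apply: le_trans hwe; rewrite /h mulrCA ler_piMr // ler_pdivrMr // mul1r ler_nat ltnW //.
  have Fk2 : absc (F s x w) / 2 <= absc (F s xk (t k * w)).
    by apply: le_trans Fk; rewrite ler_wpM2l ?absc_ge0 // half_le_loss.
  have [|x' [hx' G' F' Q']] := hstep s xk (t k * w) (t k.+1 * w) hs hxk
     (le_trans (tw1 _ (ltnW kM)) hw) (le_trans (tw1 _ kM) hw) _ Gk Fk2 Qk.
    by rewrite tstep.
  exists x'; split=> //; apply: le_trans F'; rewrite tstep.
  have u1 : 0 <= 2 * h / e0 by rewrite divr_ge0 ?mulr_ge0 // ltW.
  have u2 : 0 <= 1 - 2 * h / e0.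
    apply: le_trans (half_le_loss e0_gt0 _); rewrite ?invr_ge0 //.
    by apply: le_trans hwe; rewrite ler_piMr // invf_le1 // ler1n.
  apply: (@le_trans _ _ (absc (F s x w) * (1 - 2 * (k%:R * h) / e0) * (1 - 2 * h / e0))).
    rewrite -[leRHS]mulrA ler_wpM2l ?absc_ge0 //.
    have -> : 2 * (k.+1%:R * h) / e0 = 2 * (k%:R * h) / e0 + 2 * h / e0.
      by rewrite -natr1; ring.
    by rewrite loss_add // divr_ge0 ?mulr_ge0 // ltW.
  by rewrite ler_wpM2r.
have [xM []] := claim M (leqnn _).
have -> : t M * w = 0 by rewrite /t subrr mul0r mul0r.
move=> hxM GM FM _; have xM0 : xM = 0 by apply: (G_isolated hs _ GM); lra.
have Fs0 : F s 0 0 = 0 by have := F00; rewrite /F !mulr0.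
move: FM; rewrite xM0 Fs0.
have -> : M%:R * h = absc w by rewrite /h mulrCA divff ?mulr1 ?gt_eqF.
rewrite absc0 leNgt => /negP; apply; rewrite mulr_gt0 //.
by apply: lt_le_trans (half_le_loss e0_gt0 hwe); rewrite invr_gt0.
Qed.

End Walk.

(** * The estimate on the polar curves *)

Lemma line_increment (K : comNzRingType) (s x x' w w' : K) :
  w' - s * x' - (w - s * x) = (w' - w) - s * (x' - x).
Proof. by ring. Qed.

Section PolarEstimate.
Variable R : realType.
Local Notation C := (complex R).
Local Notation MP := (mpoly 2 C).
Implicit Types (f : MP) (s x y w : C).

Lemma msize_mderiv i f n : (mmeasure mdeg f <= n.+1)%N -> (mmeasure mdeg (mderiv i f) <= n)%N.
Proof.
move=> fn; rewrite mmeasureE; apply/bigmax_leqP_seq => m; rewrite mcoeff_msupp mcoeff_deriv => m0 _.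
have : mcoeff (mnm_add m (mnm1 i)) f != 0 by apply: contraNneq m0 => ->; rewrite mul0rn.
rewrite -mcoeff_msupp => /msize_mdeg_lt; rewrite mdegD mdeg1 addn1 => lt_m.
by rewrite -ltnS (leq_trans lt_m).
Qed.

Lemma slice_deriv_horner f s w x : (slice f s w)^`().[x] =
  ev (dx f) x (w - s * x) - s * ev (dy f) x (w - s * x).
Proof. by rewrite slice_deriv hornerD hornerN hornerZ (slice_horner (dx f)) (slice_horner (dy f)). Qed.

Lemma slice_deriv_lipschitz f (delta rho : R) : 0 <= delta ->
  exists2 L : R, 0 < L & forall s x w w', absc s = delta -> absc x <= rho ->
    absc (w - s * x) <= rho -> absc (w' - s * x) <= rho ->
    absc ((slice f s w')^`().[x] - (slice f s w)^`().[x]) <= L * absc (w' - w).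
Proof.
move=> delta0; have [Lp Lp0 hLp] := ev_lipschitz (dx f) rho.
have [Lq Lq0 hLq] := ev_lipschitz (dy f) rho.
exists (Lp + delta * Lq) => [|s x w w' hs bx by_ by'].
  by rewrite ltr_wpDr // mulr_ge0 // ltW.
have dw : w' - s * x - (w - s * x) = w' - w by rewrite opprB addrA subrK.
rewrite !slice_deriv_horner.
have h1 := hLp _ _ _ _ bx by_ bx by'; have h2 := hLq _ _ _ _ bx by_ bx by'.
rewrite subrr absc0 add0r dw in h1; rewrite subrr absc0 add0r dw in h2.
rewrite opprD addrACA -opprD -mulrBr mulrDl (le_trans (absc_leB _ _)) // lerD //.
by rewrite abscM hs -mulrA ler_wpM2l.
Qed.

Lemma polar_gap f e : (mmeasure mdeg f <= e.+2)%N ->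
  exists2 B : {poly C}, B != 0 & forall delta c : R, 0 < c ->
    (forall s, absc s = delta -> c <= absc B.[s]) ->
    exists e0 M, [/\ 0 < e0, 0 < M & forall s x y, absc s = delta ->
      ev (dx f) x y = s * ev (dy f) x y -> ev (dy f) x y != 0 -> absc (ev (dy f) x y) <= 1 ->
      absc (ev f x y) <= e0 * absc (ev (dy f) x y) ->
      absc (ev f x y) ^+ (e ^ 2) <= M * absc (ev (dy f) x y) ^+ (e ^ 2).+1].
Proof.
move=> fe; have [D [a [a0 rel]]] := algebraic_relation fe (msize_mderiv 0 fe) (msize_mderiv 1 fe).
have [|t|B B0 hB] := @small_ratio_gap R _ a (fun t => t.1) (fun t => tag t.2) (fun t => tagged t.2) (e ^ 2) _ a0.
- move=> [k [i j]] [k' [i' j']] /= [/val_inj-> /val_inj ii'].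
  by subst i' => /val_inj->.
- by rewrite -ltnS.
exists B => // delta c c0 hc; have [e0 [M [e0_gt0 M0 hM]]] := hB delta c c0 hc.
exists e0, M; split=> // s x y hs pq q0 q1 fq; apply: (hM s) => //; first by rewrite absc_gt0.
rewrite -[RHS](meval0 (pt x y)) -[in RHS]rel raddf_sum; apply: eq_bigr => t _ /=.
by rewrite mevalZ !mevalM !rmorphXn /= -pq.
Qed.

(** On a generic circle of directions the leading term (k + 1) b(s) x^k of the
    derivative dominates near 0, uniformly in [s]. *)
Lemma isolated_on_slices f (delta c B : R) k b : 0 < c -> 0 < B ->
  (forall s, absc s = delta -> c <= absc b.[s]) ->
  (forall s x, absc s <= delta -> absc x <= 1 ->
     absc ((slice f s 0)^`().[x] - k.+1%:R * b.[s] * x ^+ k) <= B * absc x ^+ k.+1) ->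
  forall s x, absc s = delta -> absc x <= Num.min 1 (c / (2 * B)) ->
    c / 2 * absc x ^+ k <= absc (slice f s 0)^`().[x].
Proof.
move=> c0 B0 hc hB s x hs; rewrite le_min => /andP[x1 xc].
have := hB s x; rewrite hs => /(_ (lexx _) x1) h1.
have h2 := absc_geB (k.+1%:R * b.[s] * x ^+ k) (k.+1%:R * b.[s] * x ^+ k - (slice f s 0)^`().[x]).
rewrite subKr absc_distC in h2.
have h3 : c * absc x ^+ k <= absc (k.+1%:R * b.[s] * x ^+ k).
  rewrite !abscM absc_nat abscX ler_wpM2r ?exprn_ge0 ?absc_ge0 //.
  by apply: le_trans (hc s hs) _; rewrite ler_peMl ?absc_ge0 // ler1n.
have h4 : B * absc x ^+ k.+1 <= c / 2 * absc x ^+ k.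
  rewrite exprS mulrA ler_wpM2r ?exprn_ge0 ?absc_ge0 //.
  by move: xc; rewrite ler_pdivlMr ?mulr_gt0 //; lra.
by lra.
Qed.

(** Along the generic circle |s| = delta the gap and the walk apply, hence
    |f|^N <= M |q|^(N+1) where f <> 0; in particular f vanishes at the critical
    points close to the origin.  The last clause is the behaviour on the lines
    through the origin, which bounds the gradient from below on the boundary of
    the discs used later. *)
Lemma polar_estimate f e : f != 0 -> (mmeasure mdeg f <= e.+2)%N ->
  ev f 0 0 = 0 -> ev (dx f) 0 0 = 0 -> ev (dy f) 0 0 = 0 ->
  exists delta r M : R, [/\ 0 < delta, 0 < r, 0 < M,
    forall x y, absc x <= r -> absc y <= r ->
      absc (ev (dx f) x y) = delta * absc (ev (dy f) x y) -> ev f x y != 0 ->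
      ev (dy f) x y != 0 /\
      absc (ev f x y) ^+ (e ^ 2) <= M * absc (ev (dy f) x y) ^+ (e ^ 2).+1 &
    exists k c, 0 < c /\ forall s x, absc s = delta -> absc x <= r ->
      c * absc x ^+ k <= absc (slice f s 0)^`().[x]].
Proof.
move=> f0 fe f00 p00 q00.
have [k [b b0 hb]] := lowest_form f0 f00.
have [B B0 hB] := polar_gap fe.
have [r1 r1_gt0 hr1] := lead_coef_le_horner b0.
have [r2 r2_gt0 hr2] := lead_coef_le_horner B0.
(* Every large radius is generic for both polynomials [b] and [B]. *)
pose delta := Num.max r1 r2.
have delta0 : 0 < delta by rewrite lt_max r1_gt0.
have hbd s : absc s = delta -> absc (lead_coef b) <= absc b.[s].
  by move=> hs; apply: hr1; rewrite hs le_max lexx.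
have hBd s : absc s = delta -> absc (lead_coef B) <= absc B.[s].
  by move=> hs; apply: hr2; rewrite hs le_max lexx orbT.
have lb0 : 0 < absc (lead_coef b) by rewrite absc_gt0 lead_coef_eq0.
have lB0 : 0 < absc (lead_coef B) by rewrite absc_gt0 lead_coef_eq0.
have [e0 [M [e0_gt0 M0 gapM]]] := hB _ _ lB0 hBd.
have [Bb Bb0 hBb] := hb delta.
have low := isolated_on_slices lb0 Bb0 hbd hBb.
set c1 := absc (lead_coef b) / 2 in low; set eps1 := Num.min 1 _ in low.
have c1_gt0 : 0 < c1 by rewrite divr_gt0.
have eps1_gt0 : 0 < eps1 by rewrite lt_min ltr01 divr_gt0 ?mulr_gt0.
have eps1_le1 : eps1 <= 1 by rewrite ge_min lexx.
pose rho := 1 + delta.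
have rho0 : 0 < rho by rewrite addr_gt0.
have [Lq Lq0 hLq] := ev_lipschitz (dy f) rho.
have [Lt Lt0 hLt] := ev_taylor f rho.
have [LG LG0 hLG] := slice_deriv_lipschitz f rho (ltW delta0).
(* For |q| <= rq the bound of the gap is below (e0 / 2)^N |q|^N. *)
pose rq := Num.min 1 ((e0 / 2) ^+ (e ^ 2) / (2 * M)).
have rq0 : 0 < rq by rewrite lt_min ltr01 divr_gt0 ?mulr_gt0 ?exprn_gt0 ?divr_gt0.
pose eps := Num.min eps1 (rq / (2 * Lq * rho)).
have eps_gt0 : 0 < eps by rewrite lt_min eps1_gt0 divr_gt0 ?mulr_gt0.
have eps_le1 : eps <= eps1 by rewrite ge_min lexx.
have eps_half : eps / 2 <= eps by rewrite ler_pdivrMr // ler_peMr ?ler1n // ltW.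
pose c0 := c1 * (eps / 2) ^+ k / 2.
have c0_gt0 : 0 < c0 by rewrite /c0 divr_gt0 // mulr_gt0 // exprn_gt0 // divr_gt0.
pose w1 := Num.min 1 (Num.min (c0 / LG) (rq / (2 * Lq))).
have w1_gt0 : 0 < w1.
  by rewrite !lt_min ltr01 (divr_gt0 c0_gt0 LG0) divr_gt0 // mulr_gt0.
have w1_le1 : w1 <= 1 by rewrite ge_min lexx.
have inbox s x w : absc s = delta -> absc x <= eps -> absc w <= w1 ->
    absc x <= rho /\ absc (w - s * x) <= rho.
  move=> hs hx hw; have hx1 : absc x <= 1 by rewrite (le_trans hx) // (le_trans eps_le1).
  split; first by rewrite /rho; lra.
  apply: (le_trans (absc_leB _ _)); rewrite abscM hs /rho lerD ?(le_trans hw) //.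
  by rewrite ler_piMr // ltW.
have dw s x w w' : w' - s * x - (w - s * x) = w' - w by rewrite opprB addrA subrK.
have G_lip s x w w' : absc s = delta -> absc x <= eps -> absc w <= w1 -> absc w' <= w1 ->
    absc ((slice f s w')^`().[x] - (slice f s w)^`().[x]) <= LG * absc (w' - w).
  move=> hs hx hw hw'; have [bx by_] := inbox s x w hs hx hw; have [_ by'] := inbox s x w' hs hx hw'.
  exact: hLG.
have Q_lip s x w x' w' : absc s = delta -> absc x <= eps -> absc x' <= eps ->
    absc w <= w1 -> absc w' <= w1 ->
    absc (ev (dy f) x' (w' - s * x') - ev (dy f) x (w - s * x))
      <= Lq * ((1 + delta) * absc (x' - x) + absc (w' - w)).
  move=> hs hx hx' hw hw'; have [bx by_] := inbox s x w hs hx hw; have [bx' by'] := inbox s x' w' hs hx' hw'.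
  apply: (le_trans (hLq _ _ _ _ bx by_ bx' by')); rewrite ler_wpM2l ?(ltW Lq0) //.
  have -> : w' - s * x' - (w - s * x) = (w' - w) - s * (x' - x).
    exact: line_increment.
  have := absc_leB (w' - w) (s * (x' - x)); rewrite abscM hs mulrDl mul1r; lra.
have F_taylor s x w w' : absc s = delta -> absc x <= eps -> absc w <= w1 -> absc w' <= w1 ->
    absc (ev f x (w' - s * x) - ev f x (w - s * x) - ev (dy f) x (w - s * x) * (w' - w))
      <= Lt * absc (w' - w) ^+ 2.
  move=> hs hx hw hw'; have [bx by_] := inbox s x w hs hx hw; have [_ by'] := inbox s x w' hs hx hw'.
  by have := hLt _ _ _ bx by_ by'; rewrite dw.
have Q_small s x w : absc s = delta -> absc x <= eps -> absc w <= w1 ->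
    absc (ev (dy f) x (w - s * x)) <= rq.
  move=> hs hx hw; have := Q_lip s 0 0 x w hs _ hx _ hw.
  rewrite !absc0 mulr0 !subr0 q00 subr0 => /(_ (ltW eps_gt0) (ltW w1_gt0)) h.
  apply: (le_trans h).
  have h1 : Lq * ((1 + delta) * absc x) <= rq / 2.
    have := le_trans hx (_ : eps <= rq / (2 * Lq * rho)); rewrite ge_min lexx orbT => /(_ isT).
    by rewrite ler_pdivlMr ?mulr_gt0 // /rho; lra.
  have h2 : Lq * absc w <= rq / 2.
    have := le_trans hw (_ : w1 <= rq / (2 * Lq)); rewrite !ge_min lexx !orbT => /(_ isT).
    by rewrite ler_pdivlMr ?mulr_gt0 //; lra.
  by lra.
have LGw w : absc w <= w1 -> LG * absc w <= c0.
  move=> hw; have := le_trans hw (_ : w1 <= c0 / LG); rewrite !ge_min lexx !orbT => /(_ isT).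
  by rewrite ler_pdivlMr // mulrC.
have far s x w : absc s = delta -> eps / 2 <= absc x -> absc x <= eps -> absc w <= w1 ->
    c0 <= absc (slice f s w)^`().[x].
  move=> hs hx hx' hw; have := G_lip s x 0 w hs hx'; rewrite absc0 subr0 => /(_ (ltW w1_gt0) hw) h1.
  have h2 := LGw w hw; have h3 := low s x hs (le_trans hx' eps_le1).
  have h4 : 2 * c0 <= c1 * absc x ^+ k.
    have -> : 2 * c0 = c1 * (eps / 2) ^+ k by rewrite /c0 mulrC mulfVK.
    by rewrite ler_wpM2l ?(ltW c1_gt0) // lerXn2r ?nnegrE ?absc_ge0 // divr_ge0 // ltW.
  apply: le_trans (absc_perturb (le_trans h4 h3) (le_trans h1 h2)).
  by rewrite mulr_natl mulr2n addrK.
have stay s x w : absc s = delta -> absc x <= eps -> absc w <= w1 ->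
    (slice f s w)^`().[x] = 0 -> absc x <= eps / 2.
  move=> hs hx hw G0; rewrite leNgt; apply/negP => /ltW hx2.
  by have := far s x w hs hx2 hx hw; rewrite G0 absc0; lra.
have big s w : absc s = delta -> absc w <= w1 -> c0 <= absc (slice f s w)^`().[eps%:C%C].
  by move=> hs hw; apply: far; rewrite // absc_real (ger0_norm (ltW eps_gt0)) //; lra.
have crit s x w : (slice f s w)^`().[x] = 0 ->
    ev (dx f) x (w - s * x) = s * ev (dy f) x (w - s * x).
  by move/eqP; rewrite slice_deriv_horner subr_eq0 => /eqP.
have F_gap s x w : absc s = delta -> absc x <= eps -> absc w <= w1 ->
    (slice f s w)^`().[x] = 0 -> ev (dy f) x (w - s * x) != 0 ->
    absc (ev f x (w - s * x)) <= e0 * absc (ev (dy f) x (w - s * x)) ->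
    absc (ev f x (w - s * x)) < e0 / 2 * absc (ev (dy f) x (w - s * x)).
  move=> hs hx hw G0 Q0 FQ; have := Q_small s x w hs hx hw; rewrite le_min => /andP[q1 q2].
  have := gapM s x (w - s * x) hs (crit s x w G0) Q0 q1 FQ.
  set F := absc (ev f _ _); set Q := absc (ev (dy f) _ _) in q1 q2 *.
  have Qp : 0 < Q by rewrite absc_gt0.
  move=> hF; rewrite ltNge; apply/negP => FQ2.
  have : (e0 / 2 * Q) ^+ (e ^ 2) <= F ^+ (e ^ 2).
    by rewrite lerXn2r ?nnegrE ?absc_ge0 // mulr_ge0 ?divr_ge0 // ltW.
  move/le_trans/(_ hF); rewrite exprMn exprS mulrA ler_pM2r ?exprn_gt0 //.
  have : 0 < (e0 / 2) ^+ (e ^ 2) by rewrite exprn_gt0 // divr_gt0.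
  move: q2; rewrite ler_pdivlMr ?mulr_gt0 // => q2 E0 E1; suff : M * Q < M * Q by rewrite ltxx.
  lra.
have isol s x : absc s = delta -> absc x <= eps -> (slice f s 0)^`().[x] = 0 -> x = 0.
  move=> hs hx G0; have := low s x hs (le_trans hx eps_le1); rewrite G0 absc0.
  rewrite leNgt => h; apply/eqP; apply: contraNT h => x0.
  by rewrite mulr_gt0 // exprn_gt0 // absc_gt0.
have F00 : ev f 0 (0 - 0 * 0) = 0 by rewrite mulr0 subr0.
have hwalk := @walk R f e.+1 delta eps w1 e0 c0 LG Lq Lt fe (ltW delta0) eps_gt0 e0_gt0
  c0_gt0 LG0 Lq0 Lt0 stay big G_lip Q_lip F_taylor F_gap F00 isol.
pose r := Num.min (eps / 2) (Num.min w1 (e0 / 4) / rho).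
have r0 : 0 < r by rewrite lt_min !divr_gt0 // lt_min w1_gt0 divr_gt0.
have r_eps : r <= eps / 2 by rewrite ge_min lexx.
exists delta, r, M; split=> //; last first.
  exists k, c1; split=> // s x hs hx; apply: low => //.
  by rewrite (le_trans hx) // (le_trans r_eps) // (le_trans eps_half).
move=> x y hx hy pq F0.
have hwl s : absc s = delta -> absc (y + s * x) <= Num.min w1 (e0 / 4).
  move=> hs; apply: (le_trans (absc_leD _ _)); rewrite abscM hs.
  apply: (@le_trans _ _ (rho * r)).
    by rewrite mulrDl mul1r lerD // ler_wpM2l // ltW.
  by rewrite -ler_pdivlMl // mulrC ge_min lexx orbT.
have hx2 : absc x <= eps / 2 by exact: le_trans hx _.
have walk_at s : absc s = delta -> ev (dx f) x y = s * ev (dy f) x y ->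
    absc (ev f x y) < e0 * absc (ev (dy f) x y).
  move=> hs pqs; have := hwl s hs; rewrite le_min => /andP[hw1 hw2].
  have := hwalk s x (y + s * x) hs hx2 hw1 hw2; rewrite slice_deriv_horner addrK; apply=> //.
  by rewrite pqs subrr.
have Q0 : ev (dy f) x y != 0.
  apply/eqP => Q0; have P0 : ev (dx f) x y = 0.
    by apply/eqP; rewrite -absc_eq0 pq Q0 absc0 mulr0.
  (* A critical point lies on all polar curves. *)
  have := walk_at delta%:C%C; rewrite absc_real ger0_norm ?(ltW delta0) // P0 Q0 mulr0.
  by move=> /(_ erefl erefl); rewrite absc0 mulr0 ltNge absc_ge0.
(* A point that is not critical lies on the polar curve of p / q. *)
split=> //; pose s := ev (dx f) x y / ev (dy f) x y.
have hs : absc s = delta by rewrite /s abscM abscV pq mulfK // absc_eq0.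
have pqs : ev (dx f) x y = s * ev (dy f) x y by rewrite /s mulfVK.
apply: (gapM s) => //; last exact: ltW (walk_at s hs pqs).
have := hwl s hs; rewrite le_min => /andP[hw1 _].
have := Q_small s x (y + s * x) hs (le_trans hx2 eps_half) hw1.
by rewrite addrK le_min => /andP[].
Qed.

End PolarEstimate.

(** * A maximum principle in one variable *)

Section MaximumPrinciple.
Variable R : realType.
Local Notation C := (complex R).
Implicit Types (g h : {poly C}) (x y z : C).

Lemma absc_le_ReIm (a b : R) : absc (Complex a b) <= `|a| + `|b|.
Proof.
rewrite /absc /= -[leRHS]ger0_norm ?addr_ge0 // -sqrtr_sqr ler_wsqrtr //.
rewrite sqrrD !real_normK ?num_real // lerD2r lerDl mulrn_wge0 // mulr_ge0 //.
Qed.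

Lemma absc_ge_Re (a b : R) : `|a| <= absc (Complex a b).
Proof. by rewrite /absc /= -sqrtr_sqr ler_wsqrtr // lerDl sqr_ge0. Qed.

Lemma absc_ge_Im (a b : R) : `|b| <= absc (Complex a b).
Proof. by rewrite /absc /= -sqrtr_sqr ler_wsqrtr // lerDr sqr_ge0. Qed.

(** The superlevel sets of [Phi] in the disc generate a proper filter; at a
    cluster point, upper semicontinuity forces the maximal value. *)
Lemma usc_attains_max (Phi : C -> R) (eps : R) : 0 <= eps ->
  (forall x t, absc x <= eps -> Phi x < t ->
     exists2 eta : R, 0 < eta & forall y, absc (y - x) < eta -> Phi y < t) ->
  exists2 x, absc x <= eps & forall y, absc y <= eps -> Phi y <= Phi x.
Proof.
move=> eps0 usc; pose c (z : R * R) : C := Complex z.1 z.2.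
pose D : set (R * R) := [set z | absc (c z) <= eps]%classic.
pose B (z : R * R) : set (R * R) := [set u | D u /\ Phi (c z) <= Phi (c u)]%classic.
have D0 : D (0, 0) by rewrite /D /= [c _](_ : _ = 0 :> C) ?absc0.
have BF : ProperFilter (filter_from D B).
  apply: filter_from_proper => [|z Dz]; last by exists z; split.
  apply: filter_from_filter; first by exists (0, 0).
  move=> u v Du Dv; have [le_uv|/ltW le_vu] := leP (Phi (c u)) (Phi (c v)).
    by exists v => // w [Dw le_vw]; do 2!split=> //; apply: le_trans le_vw.
  by exists u => // w [Dw le_uw]; do 2!split=> //; apply: le_trans le_uw.
have near_meets (z : R * R) (eta : R) (y : R * R) : 0 < eta -> cluster (filter_from D B) z -> D y ->
    exists u, [/\ absc (c u - c z) < eta, D u & Phi (c y) <= Phi (c u)].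
  (* The product topology on pairs of reals has square balls. *)
  move=> eta0 cz Dy; have [|//|u [[Du yu] [z1 z2]]] := cz (B y) (ball z (eta / 2)).
  - by exists y.
  - by apply: nbhsx_ballx; rewrite divr_gt0.
  exists u; split=> //; rewrite absc_distC.
  apply: le_lt_trans (absc_le_ReIm (z.1 - u.1) (z.2 - u.2)) _.
  move: z1 z2; rewrite -ball_normE /= => z1 z2; lra.
have cK : compact (`[- eps, eps] `*` `[- eps, eps] : set (R * R))%classic.
  by apply: compact_setX; apply: segment_compact.
have [|z [_ cz]] := cK _ BF.
  exists (0, 0) => //.
  move=> [a b] [Dab _]; rewrite /D /= in Dab; split; rewrite /= in_itv /= -ler_norml.
    exact: le_trans (absc_ge_Re a b) Dab.
  exact: le_trans (absc_ge_Im a b) Dab.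
have Dz : D z.
  rewrite /D /= leNgt; apply/negP => ez.
  rewrite -subr_gt0 in ez; have [u [uz Du _]] := near_meets _ _ _ ez cz D0.
  have := absc_geB (c z) (c u); rewrite absc_distC; rewrite /D /= in Du; lra.
exists (c z) => // y ey; rewrite leNgt; apply/negP => lt_zy.
have [eta eta0 heta] := usc _ _ Dz lt_zy.
have [|u [/heta lt_uy _]] := near_meets z eta (complex.Re y, complex.Im y) eta0 cz.
  by rewrite /D /c /=; case: y ey {lt_zy heta}.
by rewrite leNgt; case: y {ey lt_zy heta} lt_uy => a b ->.
Qed.

(** At a root of [g] of multiplicity k the left side vanishes to order
    (M N + 1) k, which is not a multiple of M because 0 < k < M, and the right
    side to an order divisible by M.  The exponents
    M N + 1 and M (N + 1) are chosen for this reason: it makes the quotients in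
    the maximum principle nonconstant. *)
Lemma power_proportional g h (c d : C) M N : (1 < size g <= M)%N ->
  c != 0 -> c *: g ^+ (M * N + 1) <> d *: h ^+ (M * N.+1).
Proof.
move=> /andP[sg sM] c0; have g0 : g != 0 by apply: contraTneq sg => ->; rewrite size_poly0.
have [r rg] : exists r, root g r.
  by apply/closed_rootP; rewrite neq_ltn sg orbT.
move=> E; have L0 : c *: g ^+ (M * N + 1) != 0 by rewrite scaler_eq0 negb_or c0 expf_neq0.
have d0 : d != 0 by apply: contraNneq L0 => d0; rewrite E d0 scale0r.
have h0 : h != 0.
  have M0 : (0 < M)%N by apply: leq_trans sM; apply: ltnW.
  by apply: contraNneq L0 => h0; rewrite E h0 expr0n muln_eq0 (gtn_eqF M0) scaler0.
have mu_scale (e : C) p : e != 0 -> mup r (e *: p) = mup r p.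
  by move=> e0; rewrite -mul_polyC mupMr // rootC.
have mu_exp p k : p != 0 -> mup r (p ^+ k) = (k * mup r p)%N.
  move=> p0; elim: k => [|k IH]; first by rewrite expr0 mupNroot // rootC oner_eq0.
  by rewrite exprS mupM ?expf_neq0 // IH mulSn.
have /(congr1 (mup r)) := E; rewrite !mu_scale // !mu_exp // => Emu.
have mu_gt0 : (0 < mup r g)%N by rewrite -XsubC_dvd // dvdp_XsubCl.
have : (M %| mup r g)%N.
  have : (M %| (M * N + 1) * mup r g)%N by rewrite Emu -mulnA dvdn_mulr.
  by rewrite Gauss_dvdr // /coprime mulnC gcdnMDl gcdn1.
move/(dvdn_leq mu_gt0); rewrite leqNgt => /negP; apply; apply: leq_trans sM.
have : ('X - r%:P) ^+ mup r g %| g by rewrite -mup_geq.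
by move/(dvdp_leq g0); rewrite size_exp_XsubC.
Qed.

(** Let m = max (|h1|, |h2|).  The function |g|^a / m^b is continuous where
    m <> 0 and tends to 0 at the common zeros of h1 and h2, which are multiple
    roots of [g]; it thus attains its maximum over the disc.  Where |h1| <> |h2|
    it is the modulus of a rational function without pole, nonconstant by
    assumption, so the maximum lies on the circle or on the set |h1| = |h2|. *)
Lemma slice_max g h1 h2 (eps M : R) (a b : nat) : 0 < eps -> 0 < M -> (0 < a)%N -> (0 < b)%N ->
  g^`() = h1 - h2 -> (1 < size g)%N ->
  (forall k, 0 < k < size g -> b * k.-1 < a * k)%N ->
  (forall h (c d : C), c != 0 -> c *: g ^+ a != d *: h ^+ b) ->
  (forall x, absc x = eps -> absc g.[x] ^+ a <= M * Num.max (absc h1.[x]) (absc h2.[x]) ^+ b) ->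
  (forall x, absc x <= eps -> absc h1.[x] = absc h2.[x] -> g.[x] != 0 ->
     h2.[x] != 0 /\ absc g.[x] ^+ a <= M * absc h2.[x] ^+ b) ->
  forall x, absc x <= eps ->
    absc g.[x] ^+ a <= M * Num.max (absc h1.[x]) (absc h2.[x]) ^+ b.
Proof.
move=> eps0 M0 a0 b0 g'E sg hab nprop bd ray.
pose m x := Num.max (absc h1.[x]) (absc h2.[x]).
pose Phi x := absc g.[x] ^+ a / m x ^+ b.
have m_ge0 x : 0 <= m x by rewrite le_max absc_ge0.
have m_ge1 x : absc h1.[x] <= m x by rewrite le_max lexx.
have m_ge2 x : absc h2.[x] <= m x by rewrite le_max lexx orbT.
have g0 x : absc x <= eps -> m x = 0 -> g.[x] = 0.
  move=> ex m0; apply/eqP; apply: contraT => gx.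
  have h10 : absc h1.[x] = 0 by apply/le_anti; rewrite absc_ge0 andbT -m0.
  have h20 : absc h2.[x] = 0 by apply/le_anti; rewrite absc_ge0 andbT -m0.
  have [|] := ray x ex _ gx; first by rewrite h10 h20.
  by rewrite -absc_eq0 h20 eqxx.
have Phi_lt x t : 0 < t -> absc g.[x] ^+ a < t * m x ^+ b -> Phi x < t.
  move=> t0 lt_t; have mb : 0 < m x ^+ b.
    by rewrite -(pmulr_rgt0 _ t0); apply: le_lt_trans lt_t; rewrite exprn_ge0 ?absc_ge0.
  by rewrite /Phi ltr_pdivrMr.
have Phi_ge0 x : 0 <= Phi x by rewrite divr_ge0 ?exprn_ge0 ?absc_ge0.
have usc_h h x t : (forall y, absc h.[y] <= m y) -> 0 < t ->
    absc g.[x] ^+ a < t * absc h.[x] ^+ b ->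
    exists2 eta : R, 0 < eta & forall y, absc (y - x) < eta -> Phi y < t.
  move=> hm t0 lt_t; pose d := t * absc h.[x] ^+ b - absc g.[x] ^+ a.
  have d0 : 0 < d by rewrite subr_gt0.
  have [e1 e10 he1] := horner_continuous (g ^+ a) x (divr_gt0 d0 (ltr0Sn _ 1)).
  have [|e2 e20 he2] := @horner_continuous _ (h ^+ b) x (d / (2 * t)).
    by rewrite divr_gt0 ?mulr_gt0.
  exists (Num.min e1 e2); first by rewrite lt_min e10.
  move=> y; rewrite lt_min => /andP[/he1 y1 /he2 y2]; apply: Phi_lt => //.
  apply: (@lt_le_trans _ _ (t * absc h.[y] ^+ b)); last first.
    by rewrite ler_wpM2l ?(ltW t0) // lerXn2r ?nnegrE ?absc_ge0.
  rewrite ltr_pdivlMr ?mulr_gt0 // in y2; rewrite !horner_exp in y1 y2.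
  have := absc_geB (g.[y] ^+ a) (g.[x] ^+ a); have := absc_geB (h.[x] ^+ b) (h.[y] ^+ b).
  rewrite [absc (h.[x] ^+ b - _)]absc_distC !abscX => z1 z2.
  have : t * absc h.[x] ^+ b - t * absc h.[y] ^+ b < d / 2.
    by rewrite -mulrBr; apply: le_lt_trans (ler_wpM2l (ltW t0) z1) _; lra.
  by rewrite /d in y1 *; lra.
have usc x t : absc x <= eps -> Phi x < t ->
    exists2 eta : R, 0 < eta & forall y, absc (y - x) < eta -> Phi y < t.
  move=> ex lt_t; have t0 : 0 < t by apply: le_lt_trans lt_t.
  have [m0|m0] := eqVneq (m x) 0.
    have rg : root g x by rewrite rootE g0.
    have [|eta eta0 heta] := @near_root_le _ g x a b (t / (2 * 2 ^+ b)) sg rg hab.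
      by rewrite divr_gt0 ?mulr_gt0 ?exprn_gt0.
    exists eta => // y /heta; rewrite g'E hornerD hornerN => le_y.
    apply: (@le_lt_trans _ _ (t / 2)); last by lra.
    have le_y2 : absc g.[y] ^+ a <= t / 2 * m y ^+ b.
      apply: (le_trans le_y); have -> : t / 2 * m y ^+ b = t / (2 * 2 ^+ b) * (2 * m y) ^+ b.
        by rewrite exprMn; field; rewrite expf_neq0 // pnatr_eq0.
      rewrite ler_wpM2l ?divr_ge0 ?mulr_ge0 ?exprn_ge0 ?(ltW t0) //.
      rewrite lerXn2r ?nnegrE ?absc_ge0 ?mulr_ge0 //.
      have := absc_leB h1.[y] h2.[y]; have := m_ge1 y; have := m_ge2 y; lra.
    have [my|my] := eqVneq (m y ^+ b) 0.
      by rewrite /Phi my invr0 mulr0 divr_ge0 // ltW.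
    by rewrite /Phi ler_pdivrMr // lt_neqAle eq_sym my exprn_ge0.
  have mp : 0 < m x by rewrite lt_neqAle eq_sym m0 m_ge0.
  move: lt_t; rewrite /Phi ltr_pdivrMr ?exprn_gt0 //.
  rewrite {1}/m; case: (leP (absc h1.[x]) (absc h2.[x])) => _ lt_t.
    exact: (usc_h h2).
  exact: (usc_h h1).
have [x0 ex0 maxx0] := usc_attains_max (ltW eps0) usc.
suff le_M : Phi x0 <= M.
  move=> x ex; have [m0|m0] := eqVneq (m x) 0.
    by rewrite g0 // absc0 expr0n gtn_eqF //= mulr_ge0 ?exprn_ge0 // ?(ltW M0) // m_ge0.
  have mp : 0 < m x ^+ b by rewrite exprn_gt0 // lt_neqAle eq_sym m0 m_ge0.
  by rewrite -/(m x) -ler_pdivrMr // (le_trans (maxx0 x ex)).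
rewrite leNgt; apply/negP => M_lt.
have mp : 0 < m x0.
  rewrite lt_neqAle m_ge0 andbT; apply: contraTneq M_lt => m0.
  by rewrite /Phi -m0 expr0n gtn_eqF //= invr0 mulr0 -leNgt ltW.
have gx0 : g.[x0] != 0.
  apply: contraTneq M_lt => g00; rewrite /Phi g00 absc0 expr0n gtn_eqF //= mul0r -leNgt.
  exact: ltW.
have lt_M : M * m x0 ^+ b < absc g.[x0] ^+ a by rewrite -ltr_pdivlMr ?exprn_gt0.
have lt_e : absc x0 < eps.
  rewrite lt_neqAle ex0 andbT; apply: contraTneq lt_M => /bd; rewrite -/(m x0).
  by rewrite leNgt.
have ne_h : absc h1.[x0] != absc h2.[x0].
  apply: contraTneq lt_M => hE; have [_] := ray x0 ex0 hE gx0.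
  by rewrite /m hE maxxx leNgt.
(* Near [x0] the larger of the two moduli stays the larger one, so that
   g^a / h^b has a local maximum at [x0]. *)
have key h h' : (forall y, m y = Num.max (absc h.[y]) (absc h'.[y])) ->
    absc h'.[x0] < absc h.[x0] -> False.
  move=> mE lt_h.
  pose d := (absc h.[x0] - absc h'.[x0]) / 2.
  have d0 : 0 < d by rewrite divr_gt0 // subr_gt0.
  have [e1 e10 he1] := horner_continuous h x0 d0.
  have [e2 e20 he2] := horner_continuous h' x0 d0.
  have hx0 : h.[x0] != 0 by rewrite -absc_gt0; apply: le_lt_trans lt_h; apply: absc_ge0.
  have [||||y] := @no_local_max_quotient _ (g ^+ a) (h ^+ b) x0
      (Num.min (eps - absc x0) (Num.min e1 e2)).
  - by rewrite horner_exp expf_neq0.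
  - by rewrite horner_exp expf_neq0.
  - by rewrite nprop // horner_exp expf_neq0.
  - by rewrite !lt_min subr_gt0 lt_e e10.
  rewrite !lt_min => /andP[ye /andP[/he1 y1 /he2 y2]].
  have ey : absc y <= eps by have := absc_leD (y - x0) x0; rewrite subrK; lra.
  have lt_hy : absc h'.[y] < absc h.[y].
    have := absc_geB h.[x0] h.[y]; have := absc_geB h'.[y] h'.[x0].
    by rewrite [absc (h.[x0] - _)]absc_distC; rewrite /d in y1 y2; lra.
  have my : m y = absc h.[y] by rewrite mE max_l // ltW.
  have mx : m x0 = absc h.[x0] by rewrite mE max_l // ltW.
  have hy0 : 0 < absc h.[y] by apply: le_lt_trans lt_hy; apply: absc_ge0.
  rewrite !horner_exp !abscX ltNge => /negP; apply.
  have := maxx0 y ey; rewrite /Phi my mx ler_pdivrMr ?exprn_gt0 //.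
  rewrite mulrAC ler_pdivlMr ?exprn_gt0 ?absc_gt0 //.
  by rewrite [absc g.[y] ^+ a * _]mulrC.
case: (ltgtP (absc h1.[x0]) (absc h2.[x0])) ne_h => // lt_h _.
  by apply: (key h2 h1) lt_h => y; rewrite /m maxC.
exact: (key h1 h2) lt_h.
Qed.

End MaximumPrinciple.

(** * From the circle to all directions *)

Section Exponent.
Variable R : realType.
Local Notation C := (complex R).
Local Notation MP := (mpoly 2 C).
Implicit Types (f : MP) (x y w : C).

(** A root of order k <= e + 1 <= e^2 + 1 of [g] is a zero of positive order of g^a / g'^b. *)
Lemma power_order_gap e m k : (e.+2 <= m)%N -> (0 < k)%N -> (k <= e.+1)%N ->
  (m * (e ^ 2).+1 * k.-1 < (m * e ^ 2 + 1) * k)%N.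
Proof.
move=> em; case: k => // k _ ke /=.
have : (e <= e ^ 2)%N by case: e {em ke} => // e; rewrite -mulnn leq_pmulr.
have : (m * k <= m * e ^ 2)%N.
  by rewrite leq_mul2l; apply/orP; right; case: e ke em => [|e] ke em; last rewrite -mulnn; nia.
by move: (e ^ 2)%N => N h1 h2; nia.
Qed.

(** The maximum principle on the slices of direction delta, with h1 = p and
    h2 = delta q, whose difference is the derivative of the slice.  The set
    |h1| = |h2| is made of points of the polar curves treated before, and on the
    boundary circle the derivative of the slice is bounded away from 0. *)
Lemma uniform_estimate f e m : f != 0 -> (mmeasure mdeg f <= e.+2)%N -> (e.+2 <= m)%N ->
  ev f 0 0 = 0 -> ev (dx f) 0 0 = 0 -> ev (dy f) 0 0 = 0 ->
  exists r K : R, [/\ 0 < r, 0 < K & forall x y (v : R), absc x <= r -> absc y <= r ->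
    absc (ev (dx f) x y) <= v -> absc (ev (dy f) x y) <= v ->
    absc (ev f x y) ^+ (m * e ^ 2 + 1) <= K * v ^+ (m * (e ^ 2).+1)].
Proof.
move=> f0 fe em f00 p00 q00.
have [delta [r [M [delta0 r0 M0 ray [k [c [c0 low]]]]]]] := polar_estimate f0 fe f00 p00 q00.
set N := (e ^ 2)%N in ray *; pose a := (m * N + 1)%N; pose b := (m * N.+1)%N.
have m0 : (0 < m)%N by apply: leq_trans em.
have a0 : (0 < a)%N by rewrite /a addn1.
have b0 : (0 < b)%N by rewrite muln_gt0 m0.
have rho0 : 0 < 1 + delta by rewrite addr_gt0.
pose eps := r / (2 * (1 + delta)).
have eps0 : 0 < eps by rewrite divr_gt0 ?mulr_gt0.
have epsE : (1 + delta) * eps = r / 2 by rewrite /eps; field; rewrite gt_eqF.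
have deps : delta * eps = r / 2 - eps by rewrite -epsE; ring.
have eps_r : eps <= r by have : 0 < delta * eps; [rewrite mulr_gt0|lra].
have [A A0 hA] := ev_bounded f r.
have [LG LG0 hLG] := slice_deriv_lipschitz f r (ltW delta0).
pose c1 := c * eps ^+ k.
have c10 : 0 < c1 by rewrite mulr_gt0 ?exprn_gt0.
pose w2 := Num.min (r / 2) (c1 / (2 * LG)).
have w20 : 0 < w2 by rewrite lt_min (divr_gt0 r0) //= (divr_gt0 c10) // mulr_gt0.
pose s : C := delta%:C%C.
have hs : absc s = delta by rewrite absc_real ger0_norm // ltW.
have inbox x w : absc x <= eps -> absc w <= w2 -> absc x <= r /\ absc (w - s * x) <= r.
  rewrite le_min => hx /andP[hw _]; split; first exact: le_trans hx eps_r.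
  apply: (le_trans (absc_leB _ _)); rewrite abscM hs.
  have : delta * absc x <= delta * eps by rewrite ler_wpM2l // ltW.
  lra.
have w00 : absc (0 : C) <= w2 by rewrite absc0 ltW.
pose K1 := A ^+ a / (c1 / 4) ^+ b; pose K2 := A * M ^+ m / delta ^+ b.
have K10 : 0 < K1 by rewrite divr_gt0 ?exprn_gt0 // divr_gt0.
have K20 : 0 < K2 by rewrite divr_gt0 ?mulr_gt0 ?exprn_gt0.
pose K := K1 + K2; have K0 : 0 < K by rewrite addr_gt0.
have le_slice x w : absc x <= eps -> absc w <= w2 ->
    absc (ev f x (w - s * x)) ^+ a <=
    K * Num.max (absc (ev (dx f) x (w - s * x))) (delta * absc (ev (dy f) x (w - s * x))) ^+ b.
  move=> hx hw; pose g := slice f s w; pose h1 := slice (dx f) s w; pose h2 := s *: slice (dy f) s w.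
  have gE y : g.[y] = ev f y (w - s * y) by apply: slice_horner.
  have h1E y : h1.[y] = ev (dx f) y (w - s * y) by apply: slice_horner.
  have h2E y : absc h2.[y] = delta * absc (ev (dy f) y (w - s * y)).
    by rewrite hornerZ slice_horner abscM hs.
  have g'E : g^`() = h1 - h2 by apply: slice_deriv.
  have bound_far y : absc y = eps -> c1 / 2 <= absc g^`().[y].
    move=> hy; have hye : absc y <= eps by rewrite hy.
    have [by1 by2] := inbox y w hye hw.
    have [_ by3] := inbox y 0 hye w00.
    have l0 := low s y hs by1; rewrite hy -/c1 in l0.
    have l1 := hLG s y 0 w hs by1 by3 by2; rewrite subr0 in l1.
    have l3 : LG * absc w <= c1 / 2.
      move: hw; rewrite le_min => /andP[_]; rewrite ler_pdivlMr ?mulr_gt0 //; lra.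
    by have := absc_perturb l0 (le_trans l1 l3); rewrite {1}[c1]splitr addrK.
  have sg : (1 < size g)%N.
    rewrite ltnNge; apply/negP => /size1_polyC gc.
    have := bound_far eps%:C%C; rewrite absc_real (ger0_norm (ltW eps0)) gc derivC horner0 absc0.
    by move=> /(_ erefl); rewrite leNgt divr_gt0.
  have sm : (size g <= e.+2)%N by apply: leq_trans (slice_size f s w) fe.
  have := @slice_max R g h1 h2 eps K a b eps0 K0 a0 b0 g'E sg _ _ _ _ x hx.
  rewrite gE h1E h2E; apply.
  - by move=> j /andP[j0 js]; apply: power_order_gap => //; rewrite -ltnS (leq_trans js).
  - move=> h cc dd cc0; apply/eqP; apply: power_proportional => //.
    by rewrite sg (leq_trans sm).
  - move=> y hy; have hye : absc y <= eps by rewrite hy.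
    have [by1 by2] := inbox y w hye hw.
    rewrite gE; set mx := Num.max _ _.
    have mx_ge : c1 / 4 <= mx.
      have : absc h1.[y] <= mx by rewrite le_max lexx.
      have : absc h2.[y] <= mx by rewrite le_max lexx orbT.
      have := bound_far y hy; rewrite g'E hornerD hornerN.
      have := absc_leB h1.[y] h2.[y]; lra.
    apply: (@le_trans _ _ (K1 * mx ^+ b)).
      rewrite /K1 mulrAC ler_pdivlMr ?exprn_gt0 ?divr_gt0 //.
      have c14 : 0 <= c1 / 4 by rewrite divr_ge0 // ltW.
      rewrite ler_pM ?exprn_ge0 ?absc_ge0 // lerXn2r ?nnegrE ?absc_ge0 ?hA ?(ltW A0) //.
      exact: le_trans mx_ge.
    by rewrite ler_wpM2r ?exprn_ge0 // ?lerDl ?(ltW K20) // (le_trans _ mx_ge) // divr_ge0 // ltW.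
  move=> y hy; rewrite h1E h2E gE => pq F0; have [by1 by2] := inbox y w hy hw.
  have [Q0 FQ] := ray _ _ by1 by2 pq F0.
  split; first by rewrite -absc_gt0 h2E mulr_gt0 // absc_gt0.
  apply: (@le_trans _ _ (K2 * (delta * absc (ev (dy f) y (w - s * y))) ^+ b)); last first.
    by rewrite ler_wpM2r ?exprn_ge0 ?mulr_ge0 ?absc_ge0 ?(ltW delta0) // lerDr ltW.
  rewrite exprMn /K2 mulrA mulfVK ?expf_neq0 ?gt_eqF //.
  rewrite /a /b addn1 exprS [(m * N)%N]mulnC [(m * N.+1)%N]mulnC (exprM _ N) (exprM _ N.+1) -mulrA -exprMn.
  by rewrite ler_pM ?exprn_ge0 ?absc_ge0 ?hA // lerXn2r ?nnegrE ?mulr_ge0 ?exprn_ge0 ?absc_ge0 // ltW.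
pose r' := Num.min eps (w2 / (1 + delta)).
exists r', (K * (1 + delta) ^+ b); split; first by rewrite lt_min eps0 divr_gt0.
  by rewrite mulr_gt0 ?exprn_gt0.
move=> x y v hx hy hp hq; have v0 : 0 <= v by apply: le_trans hp; apply: absc_ge0.
have hx1 : absc x <= eps by apply: (le_trans hx); rewrite ge_min lexx.
have hw : absc (y + s * x) <= w2.
  apply: (le_trans (absc_leD _ _)); rewrite abscM hs.
  apply: (@le_trans _ _ ((1 + delta) * r')).
    by rewrite mulrDl mul1r lerD // ler_wpM2l // ltW.
  by rewrite -ler_pdivlMl // mulrC ge_min lexx orbT.
have := le_slice x (y + s * x) hx1 hw; rewrite addrK => h; apply: (le_trans h).
rewrite -mulrA ler_wpM2l ?(ltW K0) // -exprMn lerXn2r ?nnegrE ?le_max ?absc_ge0 //.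
  by rewrite mulr_ge0 // ltW.
rewrite ge_max mulrDl mul1r; apply/andP; split.
  by rewrite ler_wpDr ?(mulr_ge0 (ltW delta0) v0).
by rewrite ler_wpDl // ler_wpM2l // ltW.
Qed.

End Exponent.

(** * Exponents of complex and of real polynomials *)

Section Exponents.
Variable R : realType.
Local Notation C := (complex R).

Lemma le_vnorm (K : comNzRingType) (abs : K -> R) n (v : 'I_n -> K) i :
  0 <= abs (v i) -> abs (v i) <= vnorm abs v.
Proof.
move=> vi0; rewrite -{1}(ger0_norm vi0) -sqrtr_sqr ler_wsqrtr // (bigD1 i) //=.
by rewrite lerDl sumr_ge0 // => j _; apply: sqr_ge0.
Qed.

Lemma meval_pt (f : mpoly 2 C) (z : 'I_2 -> C) : meval z f = ev f (z 0) (z 1).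
Proof.
apply: meval_eq => -[[|[|//]]] i2 /=; rewrite /pt /=; congr (z _); exact/val_inj.
Qed.

Lemma gradient_exponent_of_regular (f : mpoly 2 C) (i : 'I_2) :
  ev (mderiv i f) 0 0 != 0 -> gradient_exponents (@absc R) f 0.
Proof.
rewrite -absc_gt0 => p0; set p := absc _ in p0; split=> //.
have [L L0 hL] := ev_lipschitz (mderiv i f) 1.
exists (p / 2), (Num.min 1 (p / (4 * L))); split; first by rewrite divr_gt0.
  by rewrite lt_min ltr01 divr_gt0 ?mulr_gt0.
move=> z; rewrite lt_min => /andP[z1 zL]; rewrite powRr0 mulr1.
apply: le_trans (le_vnorm (i := i) (absc_ge0 _)); rewrite /gradient meval_pt.
have h0 := le_vnorm (i := 0) (absc_ge0 (z 0)); have h1 := le_vnorm (i := 1) (absc_ge0 (z 1)).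
have z01 : absc (0 : C) <= 1 by rewrite absc0.
have := hL 0 0 (z 0) (z 1) z01 z01 (le_trans h0 (ltW z1)) (le_trans h1 (ltW z1)).
rewrite !subr0 => h2.
have h3 : L * (absc (z 0) + absc (z 1)) <= p / 2.
  by move: zL; rewrite ltr_pdivlMr ?mulr_gt0 // => zL; nra.
have := absc_geB (ev (mderiv i f) 0 0) (ev (mderiv i f) 0 0 - ev (mderiv i f) (z 0) (z 1)).
by rewrite subKr absc_distC -/p; lra.
Qed.

Lemma gradient_exponent_quotient (f : mpoly 2 C) e m :
  f != 0 -> (mmeasure mdeg f <= e.+2)%N -> (e.+2 <= m)%N ->
  ev f 0 0 = 0 -> ev (dx f) 0 0 = 0 -> ev (dy f) 0 0 = 0 ->
  gradient_exponents (@absc R) f ((m * e ^ 2 + 1)%:R / (m * (e ^ 2).+1)%:R).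
Proof.
move=> f0 fe em f00 p00 q00; set a := (m * _ + 1)%N; set b := (m * _)%N.
have b0 : (0 < b)%N by rewrite muln_gt0 andbT; apply: leq_trans em.
have b0R : 0 < b%:R :> R by rewrite ltr0n.
split; first by rewrite divr_ge0.
have [r [K [r0 K0 hK]]] := uniform_estimate f0 fe em f00 p00 q00.
pose c := K `^ (b%:R)^-1; have c0 : 0 < c by rewrite powR_gt0.
exists c^-1, r; split=> //; first by rewrite invr_gt0.
move=> z zr; set v := vnorm _ (gradient f z).
have v0 : 0 <= v by apply: sqrtr_ge0.
rewrite mulrC ler_pdivrMr //.
have hz i : absc (z i) <= r by apply: le_trans (ltW zr); apply: le_vnorm; apply: absc_ge0.
have hg i : absc (ev (mderiv i f) (z 0) (z 1)) <= v.
  by rewrite -meval_pt; apply: (le_vnorm (v := gradient f z)); apply: absc_ge0.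
have := hK (z 0) (z 1) v (hz 0) (hz 1) (hg 0) (hg 1); rewrite -/a -/b meval_pt.
set F := absc _ => hF; have F0 : 0 <= F := absc_ge0 _.
rewrite powRrM powR_mulrn //.
apply: le_trans (ge0_ler_powR _ _ _ hF) _; rewrite ?nnegrE ?exprn_ge0 ?mulr_ge0 ?exprn_ge0 ?invr_ge0 ?(ltW K0) //.
rewrite powRM ?exprn_ge0 ?(ltW K0) // -/c -(powR_mulrn b v0) -powRrM divff ?gt_eqF //.
by rewrite powRr1 // mulrC.
Qed.

(** The exponents at hand are N / (N + 1) + 1 / (m (N + 1)) with N = e^2. *)
Lemma ereal_inf_le_limit (S : set R) (e : nat) :
  (forall m, (e.+2 <= m)%N -> S ((m * e ^ 2 + 1)%:R / (m * (e ^ 2).+1)%:R)) ->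
  (ereal_inf (EFin @` S)%classic <= (1 - 1 / ((e.+1%:R - 1) ^+ 2 + 1))%:E)%E.
Proof.
move=> hS; apply/lee_addgt0Pr => t t0; rewrite -EFinD.
(* The error 1 / (m (N + 1)) is at most [t] once m t >= 1. *)
pose m := maxn e.+2 (Num.truncn t^-1).+1.
apply: (@le_trans _ _ ((m * e ^ 2 + 1)%:R / (m * (e ^ 2).+1)%:R)%:E).
  by apply: ereal_inf_lbound; exists ((m * e ^ 2 + 1)%:R / (m * (e ^ 2).+1)%:R) => //; apply: hS; rewrite leq_maxl.
rewrite lee_fin; have m0 : 0 < m%:R :> R by rewrite ltr0n leq_max.
have mt : t^-1 <= m%:R.
  apply: (@le_trans _ _ (Num.truncn t^-1).+1%:R); last by rewrite ler_nat leq_maxr.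
  have ti0 : 0 <= t^-1 by rewrite invr_ge0 ltW.
  by have /andP[_ /ltW] := truncn_itv ti0.
have mt1 : 1 <= m%:R * t by rewrite -ler_pdivrMr // mul1r.
have -> : (e.+1%:R - 1) ^+ 2 = (e ^ 2)%:R :> R by rewrite -natr1 addrK natrX.
move: (e ^ 2)%N => N; rewrite ler_pdivrMr; last by rewrite ltr0n muln_gt0 andbT -(ltr0n R).
rewrite natrD !natrM -[N.+1%:R]natr1; have N0 : 0 <= N%:R :> R by [].
have -> : (1 - 1 / (N%:R + 1) + t) * (m%:R * (N%:R + 1)) = m%:R * N%:R + (m%:R * t) * (N%:R + 1).
  by field; rewrite gt_eqF // ltr_wpDl.
by rewrite lerD2l; nra.
Qed.

Lemma mdegree0_eq0 (f : mpoly 2 C) : ev f 0 0 = 0 -> mdegree f = 0%N -> f = 0.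
Proof.
rewrite /mdegree => f00 fd; have : (mmeasure mdeg f <= 1)%N by case: (mmeasure _ f) fd => [|[]].
by move/msize1_polyC => ->; rewrite -ev00 f00 mpolyC0.
Qed.

Lemma lojasiewicz_le0 (f : mpoly 2 C) (t : R) : gradient_exponents (@absc R) f 0 ->
  (lojasiewicz_exponent (@absc R) f <= (1 - 1 / (t ^+ 2 + 1))%:E)%E.
Proof.
move=> f0; apply: (@le_trans _ _ 0%:E); first by apply: ereal_inf_lbound; exists 0.
rewrite lee_fin subr_ge0 ler_pdivrMr ?mul1r ?lerDr ?sqr_ge0 //.
by rewrite ltr_wpDl ?sqr_ge0.
Qed.

Lemma lojasiewicz_complex (f : mpoly 2 C) d :
  f <> 0 -> mdegree f = d -> meval (fun _ => 0) f = 0 ->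
  (lojasiewicz_exponent (@absc R) f <= (1 - 1 / ((d%:R - 1) ^+ 2 + 1))%:E)%E.
Proof.
move=> /eqP f0 fd; rewrite meval_pt => f00.
have [p00|p0] := eqVneq (ev (dx f) 0 0) 0; last first.
  exact: lojasiewicz_le0 (gradient_exponent_of_regular p0).
have [q00|q0] := eqVneq (ev (dy f) 0 0) 0; last first.
  exact: lojasiewicz_le0 (gradient_exponent_of_regular q0).
case: d fd => [|e] fd; first by rewrite (mdegree0_eq0 f00 fd) eqxx in f0.
apply: ereal_inf_le_limit => m em; apply: gradient_exponent_quotient => //.
by move: fd; rewrite /mdegree; case: (mmeasure _ f) => // k /= ->.
Qed.

Lemma meval_complexify n (g : mpoly n R) (z : 'I_n -> R) :
  meval (fun i => (z i)%:C%C) (map_mpoly (real_complex R) g) = (meval z g)%:C%C.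
Proof.
rewrite (mevalE z) rmorph_sum /map_mpoly /mmap raddf_sum.
apply: eq_bigr => m _; rewrite mmap1_id /= mul_mpolyC mevalZ mevalX rmorphM rmorph_prod /=.
by congr (_ * _); apply: eq_bigr => i _; rewrite rmorphXn.
Qed.

(** At a real point the complexification and its gradient take the values of
    [f] and of its gradient. *)
Lemma gradient_exponents_complexification (f : mpoly 2 R) l :
  gradient_exponents (@absc R) (map_mpoly (real_complex R) f) l ->
  gradient_exponents (@absr R) f l.
Proof.
have dC (g : mpoly 2 R) i : mderiv i (map_mpoly (real_complex R) g) = map_mpoly (real_complex R) (mderiv i g).
  by apply/mpolyP => m; rewrite mcoeff_deriv !mcoeff_map_mpoly mcoeff_deriv raddfMn.
have vC n (v : 'I_n -> R) : vnorm (@absc R) (fun i => (v i)%:C%C) = vnorm (@absr R) v.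
  by congr Num.sqrt; apply: eq_bigr => i _; rewrite absc_real.
move=> [l0 [c [eps [c0 eps0 h]]]]; split=> //; exists c, eps; split=> // z hz.
have := h (fun i => (z i)%:C%C); rewrite vC => /(_ hz); rewrite meval_complexify absc_real => /le_trans; apply.
rewrite le_eqVlt; apply/orP; left; apply/eqP; rewrite -vC.
by congr Num.sqrt; apply: eq_bigr => i _; rewrite /gradient dC meval_complexify.
Qed.

End Exponents.

(** * The bound *)

Theorem theorem4p9 (R : realType) (d : nat) :
  (forall f : mpoly 2 (complex R),
     f <> 0 -> mdegree f = d -> meval (fun _ => 0) f = 0 ->
     (lojasiewicz_exponent (@absc R) f
        <= (1 - 1 / ((d%:R - 1) ^+ 2 + 1))%:E)%E)
  /\
  (forall f : mpoly 2 R,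
     f <> 0 -> mdegree f = d -> meval (fun _ => 0) f = 0 ->
     (lojasiewicz_exponent (@absr R) f
        <= (1 - 1 / ((d%:R - 1) ^+ 2 + 1))%:E)%E).
Proof.
split=> [f|f f0 fd f00]; first exact: lojasiewicz_complex.
pose g : mpoly 2 (complex R) := map_mpoly (real_complex R) f.
have inj : injective (real_complex R) by move=> x y [].
apply: (@le_trans _ _ (lojasiewicz_exponent (@absc R) g)).
  apply: ereal_inf_le_tmp => _ [l hl <-]; exists l => //.
  exact: gradient_exponents_complexification.
have gsupp := msupp_map_mpoly f inj.
apply: lojasiewicz_complex.
- move=> /eqP; rewrite -msupp_eq0 -size_eq0 (perm_size gsupp) size_eq0 msupp_eq0.
  by move/eqP/f0.
- by rewrite -fd /mdegree !mmeasureE (perm_big _ gsupp).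
have := meval_complexify f (fun _ => 0); rewrite f00; exact.
Qed.
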